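(* Let $x_1,\dots,x_n$ be an observed sample drawn i.i.d. from a distribution $F_0$ on $\mathbb{R}$ with finite variance. Assume that: (i) there exists $\theta_0\in\Theta$ such that $F_0\in L_{\theta_0}$, and $\theta_0$ is the unique solution $\theta\in\Theta$ of the equation $f(\theta)=f(\theta_0)$; (ii) $f$ is continuous and $\Theta\subset\mathbb{R}^d$ is compact; (iii) the matrix $\Omega_0=\int_{\mathbb{R}}K(F_0(x))K(F_0(x))^T\,dx$ is non singular. Then $\hat\theta_n\to\theta_0$ in probability as $n\to\infty$, where $\hat\theta_n$ is the minimum divergence estimator $$\hat\theta_n=\arg\inf_{\theta\in\Theta}\ \inf_{T\in L''_\theta(\mathbf{F}_n^{-1})}\int_{\mathbb{R}}\varphi\left(\frac{dT}{d\lambda}\right)d\lambda .$$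
   Context: $\lambda$ (or $dx$) is Lebesgue measure on $\mathbb{R}$. $\varphi:\mathbb{R}\to[0,+\infty]$ is a strictly convex function with $\varphi(1)=0$ and $\{x:\varphi(x)<\infty\}=(a_\varphi,b_\varphi)$, $a_\varphi<1<b_\varphi$. The shifted Legendre polynomials are $L_r(t)=\sum_{k=0}^r(-1)^k\binom rk^2t^{r-k}(1-t)^k$, and for $r\ge1$, $K_r(t)=\int_0^tL_{r-1}(u)\,du$. Fix integers $2\le i_1<\dots<i_l$ (the orders of the constrained L-moments) and put $K=(K_{i_1},\dots,K_{i_l})^T:[0,1]\to\mathbb{R}^l$, $L=K'=(L_{i_1-1},\dots,L_{i_l-1})^T$. $\Theta\subset\mathbb{R}^d$ and $f:\Theta\to\mathbb{R}^l$ is a given function. For a cdf $F$, $F^{-1}(u)=\inf\{x:F(x)\ge u\}$ for $u\in(0,1)$. The model is $\bigcup_{\theta\in\Theta}L_\theta$, where $L_\theta$ is the set of probability distributions $F$ on $\mathbb{R}$ such that $\int_0^1L(u)F^{-1}(u)\,du=-f(\theta)$. $F_n$ is the empirical cdf of the sample. For a cdf $F$, $L''_\theta(\mathbf{F}^{-1})$ is the class of functions $T:\mathbb{R}\to\mathbb{R}$, differentiable $\lambda$-a.e., such that $\int_{\mathbb{R}}K(F(x))\frac{dT}{d\lambda}(x)\,\lambda(dx)=f(\theta)$; an infimum over the empty set is $+\infty$. *)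

(* Defs.v *)
From HB Require Import structures.
From mathcomp Require Export all_boot all_order all_algebra.
From mathcomp Require Export all_classical all_reals all_analysis.
Export numFieldNormedType.Exports.

Set Implicit Arguments.
Unset Strict Implicit.
Unset Printing Implicit Defensive.

Import Order.TTheory GRing.Theory Num.Theory.

Local Open Scope classical_set_scope.
Local Open Scope ring_scope.

Section divergence_function.
Context {R : realType}.
Implicit Type phi : R -> \bar R.

(* Strictness can only be required at points of the effective domain: when
   [phi x] or [phi y] is [+oo] the inequality would read [_ < +oo], and the
   non-strict convexity inequality is then trivial. *)
Definition strictly_convex phi :=
  forall x y t : R, (phi x < +oo)%E -> (phi y < +oo)%E -> x != y ->
    0 < t < 1 ->
    (phi (t * x + (1 - t) * y)%R < t%:E * phi x + (1 - t)%:E * phi y)%E.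

End divergence_function.

Section lmoments.
Context {R : realType}.
Local Notation mu := (@lebesgue_measure R).

Definition shifted_legendre (r : nat) (t : R) : R :=
  \sum_(k < r.+1)
    (-1) ^+ k * 'C(r, k)%:R ^+ 2 * t ^+ (r - k) * (1 - t) ^+ k.

Definition int_legendre (r : nat) (t : R) : R :=
  \int[mu]_(u in `[0, t]) shifted_legendre r.-1 u.

Context {l : nat}.
Implicit Type idx : 'I_l -> nat.

Definition Kvec idx (t : R) : 'cV[R]_l := \col_j int_legendre (idx j) t.

Definition Lvec idx (t : R) : 'cV[R]_l :=
  \col_j shifted_legendre (idx j).-1 t.

Definition cdf_of (F : probability (measurableTypeR R) R) (x : R) : R :=
  fine (F [set` `]-oo, x]]).

Definition quantile (F : R -> R) (u : R) : R := inf [set x | u <= F x].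

Definition ecdf (n : nat) (s : 'I_n -> R) (x : R) : R :=
  (\sum_(i < n) (s i <= x)%R%:R) / n%:R.

Context {d : nat}.
Implicit Types (f : 'cV[R]_d -> 'cV[R]_l) (theta : 'cV[R]_d).

(* The class L_theta; the existence of the integral is part of the condition. *)
Definition Lmodel idx f theta : set (probability (measurableTypeR R) R) :=
  [set F | forall j,
    mu.-integrable `]0, 1[
      (fun u => (Lvec idx u j ord0 * quantile (cdf_of F) u)%:E) /\
    \int[mu]_(u in `]0, 1[) (Lvec idx u j ord0 * quantile (cdf_of F) u)
      = - f theta j ord0].

(* The class L''_theta(F^-1).  An almost everywhere differentiable [T] and its
   derivative are Lebesgue measurable but not necessarily Borel measurable, so
   integrability is expressed by the finiteness of the integral of the absolute
   value rather than by [integrable], which asks for Borel measurability.  The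
   integral of a nonnegative function is a supremum over the Borel simple
   functions below it, which is the Lebesgue integral of any nonnegative
   Lebesgue measurable function.  The value of [derive1 T] where [T] is not
   derivable is irrelevant, these points being negligible. *)
Definition Lsec idx f theta (F : R -> R) : set (R -> R) :=
  [set T : R -> R | {ae mu, forall x : R, derivable T x 1} /\
    forall j,
      (\int[mu]_x `|Kvec idx (F x) j ord0 * derive1 T x|%:E < +oo)%E /\
      (\int[mu]_x (Kvec idx (F x) j ord0 * derive1 T x)%:E)%E
        = (f theta j ord0)%:E].

Definition min_divergence (phi : R -> \bar R) idx f (F : R -> R) theta :
    \bar R :=
  ereal_inf [set (\int[mu]_x phi (derive1 T x))%E | T in Lsec idx f theta F].

Definition Omega idx (F : R -> R) : 'M[R]_l :=
  \matrix_(r, s) \int[mu]_x (Kvec idx (F x) *m (Kvec idx (F x))^T) r s.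

End lmoments.

Definition arginf {R : realType} {E : Type} (A : set E) (D : E -> \bar R) :
    set E :=
  [set x | A x /\ forall y, A y -> (D x <= D y)%E].

Section probability_notions.
Context {dT : measure_display} {T : measurableType dT} {R : realType}.
Variable P : probability T R.

Definition mutually_independent (X : nat -> {RV P >-> R}) :=
  forall (s : seq nat) (A : nat -> set R), uniq s ->
    (forall i, measurable (A i)) ->
    P (\bigcap_(i in [set` s]) (X i @^-1` A i)) =
    (\prod_(i <- s) P (X i @^-1` A i))%E.

Definition has_law (F : probability (measurableTypeR R) R)
    (X : {RV P >-> R}) :=
  forall A : set R, measurable A -> distribution P X A = F A.

(* [P^*] is the outer measure of [P]; it agrees with [P] on measurable sets
   ([measurable_mu_extE]), so that this is the usual convergence in probability
   as soon as the [Y n] are measurable, and it still makes sense for a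
   selection [Y n] of an arg inf that is not known to be measurable. *)
Definition cvg_in_probability {V : normedModType R} (Y : nat -> T -> V)
    (y : V) :=
  forall eps : R, 0 < eps ->
    (P^*)%mu [set w | eps <= `|Y n w - y|] @[n --> \oo] --> 0%E.

End probability_notions.

(* Main.v *)
From HB Require Import structures.
Require Import Defs.
From mathcomp Require Import measurable_realfun ring lra.
Set Implicit Arguments.
Unset Strict Implicit.
Unset Printing Implicit Defensive.
Import Order.TTheory GRing.Theory Num.Theory.
Local Open Scope classical_set_scope.
Local Open Scope ring_scope.

(* Integration by parts (Fubini) turns the membership of F_0 in the model into
   the identity [int K(F_0) dx = f theta0]. For a cdf F let D_F(v) be the
   infimum of [int phi(T')] over the T such that [int K(F) T' = v]; the
   criterion is [D_F (f theta)], and D_F vanishes at [v_F = int K(F)], where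
   T = id is feasible.  Strict convexity makes phi(1 + h) grow at least linearly
   away from h = 0, so D_F is bounded below by a positive constant off any
   neighbourhood of v_F.  Convexity makes phi(1 + h) at most linear near h = 0;
   perturbing a feasible T by a primitive of [lambda . K(F_0)], which reaches
   every small displacement of v because Omega_0 is invertible, shows that D_F
   is Lipschitz near v_F.  Both bounds are uniform for F close to F_0 in L^1.
   Hence, as soon as [int |F_n - F_0| dx] is small, the arg inf is nonempty
   (a continuous function on a compact set) and is contained in a small
   neighbourhood of theta0, by compactness and identifiability.  Finally
   [E int |F_n - F_0| dx] tends to 0 by Tonelli and dominated convergence, since
   [E |F_n(x) - F_0(x)|] is at most both [1 / sqrt n] and twice the tail of F_0. *)

(** * Lower integrals of possibly nonmeasurable functions *)

(* [phi \o derive1 T] need not be measurable, and [\int] is then the supremum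
   over the simple functions below the integrand. *)
Section lower_integral.
Local Open Scope ereal_scope.
Context d (T : measurableType d) (R : realType).
Variable mu : {measure set T -> \bar R}.
Implicit Types f g : T -> \bar R.

Import HBNNSimple.

(** A simple function below [f], set to zero on the exceptional null set, keeps its integral and
    lies below [g] everywhere. Neither function has to be measurable. *)
Lemma ge0_ae_le_lower_integral f g :
  (forall x, 0 <= f x) -> (forall x, 0 <= g x) ->
  {ae mu, forall x, f x <= g x} -> \int[mu]_x f x <= \int[mu]_x g x.
Proof.
move=> f0 g0 [N [mN N0 fgN]].
rewrite (ge0_integralTE _ f0) (ge0_integralTE _ g0).
apply: ge_ereal_sup => _ [h /= hf <-].
pose h' := proj_nnsfun h (measurableC mN).
have -> : sintegral mu h = sintegral mu h'.
  rewrite -!integralT_nnsfun; apply: ge0_ae_eq_integral => //.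
  - exact/measurable_EFinP.
  - exact/measurable_EFinP.
  - by move=> x _; rewrite lee_fin.
  - by move=> x _; rewrite lee_fin.
  exists N; split => // x /= hx; apply: contrapT => Nx; apply: hx => _.
  by rewrite /= mindicE mem_set// mulr1.
apply: ereal_sup_ubound; exists h' => //= x; rewrite mindicE.
have [|] := boolP (x \in ~` N); rewrite ?inE => Nx; last by rewrite mulr0.
rewrite mulr1 (le_trans (hf x))//.
by apply: contrapT => /= xfg; apply: Nx; exact: fgN.
Qed.

Lemma ge0_le_lower_integral f g : (forall x, 0 <= f x) ->
  (forall x, f x <= g x) -> \int[mu]_x f x <= \int[mu]_x g x.
Proof.
move=> f0 fg; apply: ge0_ae_le_lower_integral => //.
  by move=> x; exact: le_trans (fg x).
exact: aeW.
Qed.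

Lemma ae_eq_lower_integral f g :
  {ae mu, forall x, f x = g x} -> \int[mu]_x f x = \int[mu]_x g x.
Proof.
move=> fg; rewrite integralE [RHS]integralE.
have aux (f1 g1 : T -> \bar R) : (forall x, 0 <= f1 x) -> (forall x, 0 <= g1 x) ->
    {ae mu, forall x, f1 x = g1 x} -> \int[mu]_x f1 x = \int[mu]_x g1 x.
  move=> f0 g0 fg1; apply/eqP; rewrite eq_le; apply/andP; split;
    apply: ge0_ae_le_lower_integral => //;
    by apply: filterS fg1 => x ->.
by congr (_ - _); apply: aux => //; apply: filterS fg => x fgx;
  rewrite ?funeposE ?funenegE fgx.
Qed.

(** A supremum over simple functions is superadditive in general; measurability of [f] yields the
    opposite inequality. If [h] is simple and below [f + g], then [max (h - f) 0] is measurable and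
    below [g]. *)
Lemma lower_integralD_le (f : T -> R) g : (forall x, 0 <= f x)%R ->
  measurable_fun setT f -> (forall x, 0 <= g x) ->
  \int[mu]_x ((f x)%:E + g x) <= \int[mu]_x (f x)%:E + \int[mu]_x g x.
Proof.
move=> f0 mf g0; rewrite ge0_integralTE; last first.
  by move=> x; rewrite adde_ge0// lee_fin.
apply: ge_ereal_sup => _ [h /= hfg <-].
pose k x := Num.max (h x - f x)%R 0%R.
have mk : measurable_fun setT k.
  by apply: measurable_maxr => //; exact: measurable_funB.
have k0 x : (0 <= k x)%R by rewrite /k le_max lexx orbT.
have kg x : (k x)%:E <= g x.
  rewrite /k maxEle; case: ifPn => // _; rewrite EFinB leeBlDl//.
apply: (@le_trans _ _ (\int[mu]_x ((f x)%:E + (k x)%:E))).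
  rewrite -integralT_nnsfun; apply: ge0_le_lower_integral.
    by move=> x; rewrite lee_fin.
  move=> x; rewrite -EFinD lee_fin -lerBlDl /k le_max lexx//.
rewrite ge0_integralD//=.
- by rewrite leeD2l//; apply: ge0_le_lower_integral => // x; rewrite lee_fin.
- by move=> x _; rewrite lee_fin.
- exact/measurable_EFinP.
- by move=> x _; rewrite lee_fin.
- exact/measurable_EFinP.
Qed.

End lower_integral.

(** * Borel versions of almost everywhere derivatives *)

Section borel_derivative.
Context {R : realType}.
Local Notation mu := (@lebesgue_measure R).

(** The shifted measure agrees with Lebesgue measure on half-open intervals, which determine it. The
    purpose is that translates of null sets are null. *)
Lemma lebesgue_measure_shift (c : R) (A : set R) : measurable A ->
  mu ((fun x => x + c) @^-1` A) = mu A.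
Proof.
move=> mA.
have mshift : measurable_fun setT (fun x : measurableTypeR R => x + c : measurableTypeR R).
  exact: measurable_funD.
pose nu : {measure set (measurableTypeR R) -> \bar R} :=
  [the measure _ _ of pushforward mu (fun x : measurableTypeR R => x + c : measurableTypeR R)].
have := @lebesgue_measure_unique R (nu mshift); move=> /(_ _ A mA) ->//.
move=> X [[a b] _ <-]; rewrite /nu /= /pushforward.
have -> : (fun x => x + c) @^-1` `]a, b] = `]a - c, b - c]%classic.
  by apply/seteqP; split => x /=; rewrite !in_itv/= ltrBlDr lerBrDr.
rewrite (@lebesgue_measure_itv R `]a, b]) (@lebesgue_measure_itv R `]a - c, b - c]).
by rewrite /= !lte_fin ltrD2r; case: ifP => // _; rewrite -!EFinB opprB addrA subrK.
Qed.

(* A function differentiable almost everywhere need not be Borel, but its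
   derivative agrees almost everywhere with the limit of the difference
   quotients of step 1/(n+1), which are Borel off a null set. *)
Lemma derive1_ae_borel (T : R -> R) : {ae mu, forall x, derivable T x 1} ->
  exists2 g : R -> R, measurable_fun setT g &
    {ae mu, forall x, derive1 T x = g x}.
Proof.
move=> Tder.
have [N [mN N0 NT]] : exists N : set R, [/\ measurable N, mu N = 0%E &
    forall x : R, ~ N x -> derivable T x 1].
  case: Tder => N [mN N0 NT]; exists N; split => // x Nx.
  by apply: contrapT => dTx; apply/Nx/NT.
pose h n : R := n.+1%:R^-1.
(* Off [M], the point [x] and all the points [x + h n] avoid [N], so every difference quotient only
   evaluates [T] where it is continuous. *)
pose M : set R := N `|` \bigcup_n ((fun x => x + h n) @^-1` N).
have msh n : measurable ((fun x : R => x + h n) @^-1` N).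
  rewrite -[X in measurable X]setTI.
  have : measurable_fun setT (fun x : measurableTypeR R => x + h n : measurableTypeR R).
    exact: measurable_funD.
  exact.
have mM : measurable M.
  by apply: measurableU => //; exact: bigcupT_measurable.
have M0 : mu M = 0%E.
  apply: measure_negligible => //; apply: negligibleU.
    by exists N; split.
  apply: negligible_bigcup => n; apply/negligibleP => //.
    exact: msh.
  exact: etrans (lebesgue_measure_shift _ mN) N0.
have mT : measurable_fun (~` N) T.
  apply: subspace_continuous_measurable_fun; first exact: measurableC.
  apply: continuous_in_subspaceT => x; rewrite inE => Nx.
  exact/differentiable_continuous/derivable1_diffP/NT.
have mdT : measurable_fun (~` M) (derive1 T).
  have := @measurable_fun_cvg _ _ R (~` M)
    (fun n x => (h n)^-1 * (T (x + h n) - T x)) (derive1 T).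
  apply.
    move=> n; apply: measurable_funM; first exact: measurable_cst.
    apply: measurable_funB.
      apply: (@measurable_comp _ _ _ _ _ _ (~` N)) => //.
      - exact: measurableC.
      - by move=> _ [x Mx <-] Nx; apply: Mx; right; exists n.
      - exact: measurable_funD.
    apply: (measurable_funS _ _ mT); first exact: measurableC.
    by move=> x Mx Nx; apply: Mx; left.
  move=> x Mx.
  have /NT : ~ N x by move=> Nx; apply: Mx; left.
  rewrite /derivable => dTx.
  have /cvgr_dnbhsP/(_ h) : k^-1 *: (T (k + x) - T x) @[k --> 0^'] --> derive1 T x.
    rewrite /derive1; move: dTx; rewrite (_ : (fun k : R => _) =
      fun k => k^-1 *: (T (k + x) - T x))//.
    by apply/funext => k; rewrite /= /GRing.scale/= mulr1.
  rewrite [X in _ -> X @ _ --> _](_ : _ =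
    fun n => (h n)^-1 *: (T (h n + x) - T x)).
    2: by apply/funext => n; rewrite (addrC x).
  apply; split => [n|]; first by rewrite gt_eqF ?invr_gt0.
  exact: cvg_harmonic.
exists (derive1 T \_ (~` M)).
  by apply/(measurable_restrictT _ _).1 => //; exact: measurableC.
exists M; split => // x /= Tx; apply: contrapT => Mx; apply: Tx.
by rewrite patchE mem_set.
Qed.

End borel_derivative.

(** * Legendre primitives, distribution functions and L-moments *)

Section legendre.
Context {R : realType}.
Local Notation mu := (@lebesgue_measure R).

Lemma continuous_segment_integrable (L : R -> R) (s t : R) :
  continuous L -> mu.-integrable `[s, t] (EFin \o L).
Proof.
move=> cL; apply: continuous_compact_integrable; first exact: segment_compact.
exact: continuous_subspaceT.
Qed.

Lemma primitive_increment (L : R -> R) (C s t : R) : continuous L ->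
  (forall u, 0 <= u <= 1 -> `|L u| <= C) -> 0 <= s -> s <= t -> t <= 1 ->
  `|\int[mu]_(u in `[0, t]) L u - \int[mu]_(u in `[0, s]) L u| <= C * (t - s).
Proof.
move=> cL LC s0 st t1.
have iL := continuous_segment_integrable 0 t cL.
rewrite (@Rintegral_itvB _ L (BLeft 0) (BRight t) s)//.
have iL' : mu.-integrable `]s, t] (EFin \o L).
  apply: integrableS iL => //; apply: subset_itvr.
  by rewrite bnd_simp.
have -> : C * (t - s) = \int[mu]_(u in `]s, t]) C.
  rewrite Rintegral_cst//= lebesgue_measure_itv/= lte_fin.
    by case: ltgtP st => // -> _; rewrite subrr.
apply: (le_trans (le_normr_Rintegral _ iL')) => //.
apply: le_Rintegral => //.
- exact: integrable_norm.
- apply: (@integrableS _ _ _ mu `[s, t]%classic) => //.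
    by apply: subset_itvr; rewrite bnd_simp.
  by apply: continuous_segment_integrable => x; exact: cvg_cst.
- move=> x /=; rewrite in_itv/= => /andP[sx xt]; apply: LC.
  by rewrite (le_trans s0 (ltW sx))/= (le_trans xt t1).
Qed.

Lemma shifted_legendre_continuous r : continuous (@shifted_legendre R r).
Proof.
move=> t; rewrite /shifted_legendre.
apply: cvg_big; first by move=> x; exact: add_continuous.
move=> k _; apply: cvgM; first apply: cvgM.
- exact: cvg_cst.
- exact: exprn_continuous.
- exact: (@continuous_onemXn R k t).
Qed.

Lemma shifted_legendre_bounded r : exists2 C : R, 0 <= C &
  forall u : R, 0 <= u <= 1 -> `|shifted_legendre r u| <= C.
Proof.
exists (\sum_(k < r.+1) 'C(r, k)%:R ^+ 2).
  by apply: sumr_ge0 => k _; exact: sqr_ge0.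
move=> u /andP[u0 u1]; apply: (le_trans (ler_norm_sum _ _ _)).
apply: ler_sum => k _.
have u1' : 0 <= 1 - u by rewrite subr_ge0.
rewrite !normrM !normrX normrN1 expr1n mul1r normr_nat -mulrA ler_piMr ?sqr_ge0//.
rewrite (ger0_norm u0) (ger0_norm u1').
by rewrite mulr_ile1 ?exprn_ge0 ?exprn_ile1// lerBlDr lerDl.
Qed.

Lemma int_legendre0 r : @int_legendre R r 0 = 0.
Proof. by rewrite /int_legendre set_itv1 Rintegral_set1. Qed.

(** With n = r - 1, the k-th term integrates to a Beta value (n-k)! k! / (n+1)!, which cancels one
    of the two binomial factors. What remains is (1 - 1)^n / (n+1), zero because n >= 1. *)
Lemma int_legendre1 r : (2 <= r)%N -> @int_legendre R r 1 = 0.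
Proof.
case: r => [|[|r]] // _; rewrite /int_legendre /= /shifted_legendre.
set n := r.+1.
have iX a b : mu.-integrable `[0, 1] (EFin \o @XMonemX R a b).
  exact: integrable_XMonemX.
pose c k : R := (-1) ^+ k * 'C(n, k)%:R ^+ 2.
transitivity (\sum_(k < n.+1) c k *
    \int[mu]_(u in `[0, 1]) @XMonemX R (n - k) k u).
  pose g (k : 'I_n.+1) u := ((c k)%:E * (@XMonemX R (n - k) k u)%:E)%E.
  have ig k : mu.-integrable `[0, 1] (g k) by apply: integrableZl => //; exact: iX.
  transitivity (fine (\int[mu]_(u in `[0%R, 1%R]) (\sum_(k < n.+1) g k u)%E)).
    congr fine; apply: eq_integral => u _; rewrite -sumEFin.
    by apply: eq_bigr => k _; rewrite /g -EFinM /XMonemX mulrA.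
  rewrite integral_sum// -sum_fine; last by move=> k _; exact: integrable_fin_num.
  apply: eq_bigr => k _; rewrite integralZl//; last exact: iX.
  by rewrite fineM//; apply: integrable_fin_num => //; exact: iX.
transitivity (n.+1%:R^-1 * (\sum_(k < n.+1) (1 ^+ (n - k) * (-1) ^+ k) *+ 'C(n, k)) : R).
  rewrite mulr_sumr; apply: eq_bigr => -[k kn] _ /=.
  have -> : \int[mu]_(u in `[0, 1]) @XMonemX R (n - k) k u = beta_fun (n - k).+1 k.+1.
    by rewrite /beta_fun Rintegral_mkcond.
  rewrite beta_fun_fact subnK// expr1n mul1r /c.
  have nf : n`!%:R = 'C(n, k)%:R * ((n - k)`! * k`!)%:R :> R.
    by rewrite -natrM (mulnC (n - k)`!) bin_fact.
  have n0 : n`!%:R != 0 :> R by rewrite pnatr_eq0 -lt0n fact_gt0.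
  rewrite (factS n) (natrM _ n.+1) invfM.
  rewrite [LHS](_ : _ = (-1) ^+ k * 'C(n, k)%:R * (n`!%:R / n`!%:R) / n.+1%:R).
    by rewrite divff// mulr1 -(mulr_natr ((-1) ^+ k)) mulrC.
  set e := (-1) ^+ k; set i := n`!%:R^-1; rewrite nf; ring.
by rewrite -exprDn subrr expr0n mulr0.
Qed.

Lemma int_legendre_lipschitz r : exists2 C : R, 0 <= C &
  forall s t : R, 0 <= s <= 1 -> 0 <= t <= 1 ->
    `|int_legendre r s - int_legendre r t| <= C * `|s - t|.
Proof.
have [C C0 LC] := shifted_legendre_bounded r.-1.
exists C => // s t /andP[s0 s1] /andP[t0 t1].
have cL := @shifted_legendre_continuous r.-1.
wlog st : s t s0 s1 t0 t1 / s <= t.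
  move=> H; have [st|/ltW ts] := leP s t; first exact: H.
  by rewrite distrC (distrC s); exact: H.
rewrite distrC (distrC s) [X in _ <= C * X]ger0_norm ?subr_ge0//.
exact: primitive_increment.
Qed.

(** The Lipschitz bound gives continuity within [0, 1], where [F] takes its values. *)
Lemma int_legendre_comp_measurable d (T : measurableType d) r (F : T -> R) :
  measurable_fun setT F -> (forall x, 0 <= F x <= 1) ->
  measurable_fun setT (fun x => int_legendre r (F x)).
Proof.
move=> mF F01; have [C C0 KC] := @int_legendre_lipschitz r.
have := @measurable_comp _ _ _ T R R `[0%R, 1%R]%classic (@int_legendre R r) setT F.
apply => //.
  by move=> _ [x _ <-] /=; rewrite in_itv/=.
apply: subspace_continuous_measurable_fun => //.
apply/subspace_continuousP => x /=; rewrite in_itv/= => x01.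
apply/cvgrPdist_le => e e0; rewrite near_withinE.
near=> y => /=; rewrite in_itv/= => y01.
apply: (le_trans (KC _ _ x01 y01)).
have : `|x - y| < e / (C + 1).
  near: y; apply: (@cvgr_dist_lt _ _ _ _ (nbhs_filter x) id) => //.
  by rewrite divr_gt0// ltr_wpDl.
move=> /ltW xy; apply: (@le_trans _ _ (C * (e / (C + 1)))).
  exact: ler_wpM2l.
rewrite mulrCA ler_piMr ?(ltW e0)// ler_pdivrMr ?ltr_wpDl// mul1r.
by rewrite lerDl.
Unshelve. all: by end_near. Qed.

End legendre.

(** * Distribution function, quantile and tail of F_0 *)

Section cdf.
Context {R : realType}.
Variable F0 : probability (measurableTypeR R) R.
Local Notation mu := (@lebesgue_measure R).
Local Notation F := (cdf_of F0).

(** The identity is a random variable of law [F0] on the probability space [F0]; the general facts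
    on cdfs of random variables thus apply to [cdf_of F0]. *)
Let idR : measurableTypeR R -> R := idfun.
#[local] HB.instance Definition _ :=
  @isMeasurableFun.Build _ _ _ _ idR (@measurable_id _ _ setT).

Lemma EFin_cdf_of x : (F x)%:E = F0 [set` `]-oo, x]].
Proof. by rewrite /cdf_of fineK// fin_num_measure. Qed.

Lemma EFin_ccdf_of x : (1 - F x)%:E = F0 [set` `]x, +oo[].
Proof.
rewrite EFinB EFin_cdf_of.
exact/esym/(@ccdf_1_cdf _ _ _ F0 (idR : {RV F0 >-> R})).
Qed.

Lemma cdf_of_itv01 x : 0 <= F x <= 1.
Proof.
by rewrite -2!lee_fin EFin_cdf_of measure_ge0/=; exact: probability_le1.
Qed.

Lemma cdf_of_nondecreasing : {homo F : x y / x <= y}.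
Proof.
move=> x y xy; rewrite -lee_fin !EFin_cdf_of.
exact: (@cdf_nondecreasing _ _ _ F0 (idR : {RV F0 >-> R})).
Qed.

Lemma cdf_of_measurable : measurable_fun setT F.
Proof. by apply: nondecreasing_measurable => // x y; exact: cdf_of_nondecreasing. Qed.

(** The limits of [F] at both infinities make the set under the infimum nonempty and bounded below,
    so [inf] is a genuine infimum. Right continuity of [F] then gives the implication from left to
    right. *)
Lemma quantile_le u x : 0 < u < 1 -> (quantile F u <= x) = (u <= F x).
Proof.
move=> /andP[u0 u1].
have FE : F = fine \o cdf (idR : {RV F0 >-> R}) by [].
pose S := [set x | u <= F x].
have S0 : S !=set0.
  have /fine_cvg : cdf (idR : {RV F0 >-> R}) x @[x --> +oo] --> 1%:E := cvg_cdfy1 _.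
  move=> /cvgr_gt/(_ _ u1) Fy.
  have [y Fyu] : exists y, u < F y by near (pinfty_nbhs R) => y; exists y; near: y.
  by exists y; exact: ltW.
have Slb : has_lbound S.
  have /fine_cvg : cdf (idR : {RV F0 >-> R}) x @[x --> -oo] --> 0%:E := cvg_cdfNy0 _.
  move=> /cvgr_lt/(_ _ u0) FNy.
  have [y Fyu] : exists y, F y < u by near (ninfty_nbhs R) => y; exists y; near: y.
  exists y => z Sz; rewrite leNgt; apply/negP => /ltW/cdf_of_nondecreasing Fzy.
  by have := lt_le_trans Fyu (le_trans Sz Fzy); rewrite ltxx.
apply/idP/idP => [Qx|]; last by move=> ux; exact: ge_inf.
rewrite leNgt; apply/negP => Fxu.
have rc : fine (cdf (idR : {RV F0 >-> R}) y) @[y --> x^'+] --> F x.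
  apply: fine_cvg; rewrite EFin_cdf_of.
  exact: (@cdf_right_continuous _ _ _ F0 (idR : {RV F0 >-> R})).
move/cvgr_lt : rc => /(_ _ Fxu) rc.
have [y xy Fyu] : exists2 y, x < y & F y < u.
  near x^'+ => y; exists y; first by near: y; exact: nbhs_right_gt.
  by near: y.
have [z Sz zy] : exists2 z, S z & z < y.
  by apply: inf_lt => //; exact: le_lt_trans Qx xy.
have := lt_le_trans Fyu (le_trans Sz (cdf_of_nondecreasing (ltW zy))).
by rewrite ltxx.
Unshelve. all: by end_near. Qed.

(** The two-sided tail, whose integral over the line is E|X|. It serves as dominating function both
    for K(F_0) and for the mean deviation of the empirical cdf. *)
Definition cdf_tail (x : R) : R := if 0 <= x then 1 - F x else F x.

Lemma cdf_tail_ge0 x : 0 <= cdf_tail x.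
Proof.
by have /andP[F0' F1] := cdf_of_itv01 x; rewrite /cdf_tail; case: ifP; rewrite ?subr_ge0.
Qed.

Lemma cdf_tail_measurable : measurable_fun setT cdf_tail.
Proof.
apply: measurable_fun_ifT.
- by apply: measurable_fun_ler => //; exact: measurable_cst.
- by apply: measurable_funB => //; exact: cdf_of_measurable.
- exact: cdf_of_measurable.
Qed.

Lemma cdf_of_mul_le_tail x : F x * (1 - F x) <= cdf_tail x.
Proof.
have /andP[F0' F1] := cdf_of_itv01 x; rewrite /cdf_tail; case: ifP => _.
- by rewrite ler_piMl// subr_ge0.
- by rewrite ler_piMr// lerBlDr lerDl.
Qed.

Let posR : measurableTypeR R -> R := fun x => Num.max x 0.
Let mposR : measurable_fun setT posR.
Proof. by apply: measurable_maxr => //; exact: measurable_cst. Qed.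
#[local] HB.instance Definition _ := @isMeasurableFun.Build _ _ _ _ posR mposR.

Let negR : measurableTypeR R -> R := fun x => Num.min x 0.
Let mnegR : measurable_fun setT negR.
Proof. by apply: measurable_minr => //; exact: measurable_cst. Qed.
#[local] HB.instance Definition _ := @isMeasurableFun.Build _ _ _ _ negR mnegR.

Lemma finite_variance_integrable :
  ('V_F0[fun x : R => x] < +oo)%E -> F0.-integrable setT (fun x : R => x%:E).
Proof.
(* [m] is a default value if the mean is not finite; the bound |x| <= 1 + |m| + (x - m)^2 holds for
   every real [m]. *)
rewrite /variance unlock expectation.unlock; set m := fine _ => v.
have mid : measurable_fun setT (fun x : measurableTypeR R => (x : R)) := @measurable_id _ _ setT.
apply/integrableP; split; first exact/measurable_EFinP.
pose c := 1 + `|m|.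
apply: (@le_lt_trans _ _ (\int[F0]_x (c%:E + ((x - m) ^+ 2)%:E))%E).
  apply: ge0_le_lower_integral => x //; rewrite -EFinD lee_fin /c.
  have : `|x| <= `|x - m| + `|m| by rewrite -[X in `|X| <= _](subrK m) ler_normD.
  have := sqr_ge0 (`|x - m| - 1); rewrite -(real_normK (num_real (x - m))).
  have : 0 <= `|m| := normr_ge0 _.
  by nra.
rewrite ge0_integralD//=.
- rewrite integral_cst//= probability_setT mule1 lte_add_pinfty ?ltry//.
- by move=> x _; rewrite lee_fin /c addr_ge0.
- by move=> x _; rewrite lee_fin sqr_ge0.
- by apply/measurable_EFinP; apply: measurable_funX; exact: measurable_funB.
Qed.

(** Layer-cake formula: the tail integrates to the mean of max(X, 0) over x >= 0 and to minus the
    mean of min(X, 0) over x < 0, both at most E|X|. *)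
Lemma cdf_tail_integrable :
  F0.-integrable setT (fun x : R => x%:E) -> mu.-integrable setT (EFin \o cdf_tail).
Proof.
move=> /integrableP[mid iid].
apply/integrableP; split.
  by apply/measurable_EFinP; exact: cdf_tail_measurable.
have mt (A : set R) : measurable A -> measurable_fun A (fun x => (`|cdf_tail x|)%:E).
  move=> mA; apply: (@measurable_funS _ _ _ _ setT) => //.
  by apply/measurable_EFinP; apply: measurableT_comp => //; exact: cdf_tail_measurable.
have -> : [set: R] = `[0, +oo[%classic `|` `]-oo, 0[%classic.
  by apply/seteqP; split => x //= _; rewrite !in_itv/= andbT; case: (leP 0 x) => _; [left|right].
rewrite ge0_integral_setU//=; last 2 first.
- by apply: mt; exact: measurableU.
- by apply/disj_setPS => x [/=]; rewrite !in_itv/= andbT leNgt => /negP.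
apply: lte_add_pinfty.
- have := @ge0_expectation_ccdf _ _ _ F0 (posR : {RV F0 >-> R}).
  move=> /(_ (fun x => _)) E.
  have {}E := E (fun x => ltac:(by rewrite /= /posR le_max lexx orbT)).
  rewrite (_ : integral _ _ _ = 'E_F0[posR])%E.
    rewrite expectation.unlock; apply: le_lt_trans iid.
    apply: ge0_le_lower_integral => x; rewrite lee_fin /posR ?le_max ?lexx ?orbT//=.
    by rewrite ge_max ler_norm normr_ge0.
  rewrite E; apply: eq_integral => x; rewrite inE/= in_itv/= andbT => x0.
  rewrite ger0_norm ?cdf_tail_ge0// /cdf_tail x0 EFin_ccdf_of.
  rewrite /ccdf/= /distribution /pushforward; congr (F0 _); apply/seteqP; split => y /=;
    rewrite !in_itv/= !andbT /posR lt_max.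
    by move=> ->.
  by rewrite [x < 0]ltNge x0 orbF.
- have := @le0_expectation_cdf _ _ _ F0 (negR : {RV F0 >-> R}).
  move=> E.
  have {}E := E (fun x => ltac:(by rewrite /= /negR ge_min lexx orbT)).
  rewrite (_ : integral _ _ _ = - 'E_F0[negR])%E.
    rewrite expectation.unlock.
    have -> : (\int[F0]_x (negR x)%:E = - \int[F0]_x (- negR x)%:E)%E.
      rewrite -integral_ge0N; last first.
        by move=> x _; rewrite lee_fin oppr_ge0 /negR ge_min lexx orbT.
      by apply: eq_integral => x _; rewrite -EFinN opprK.
    rewrite oppeK; apply: le_lt_trans iid.
    apply: ge0_le_lower_integral => x; rewrite lee_fin /negR.
      by rewrite oppr_ge0 ge_min lexx orbT.
    by rewrite oppr_min oppr0 /= ge_max normr_ge0 andbT -normrN ler_norm.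
  rewrite E oppeK; apply: eq_integral => x; rewrite inE/= in_itv/= => x0.
  rewrite ger0_norm ?cdf_tail_ge0// /cdf_tail leNgt x0/= EFin_cdf_of.
  rewrite /cdf/= /distribution /pushforward; congr (F0 _); apply/seteqP; split => y /=;
    rewrite !in_itv/= /negR ge_min.
    by move=> ->.
  by rewrite [0 <= x]leNgt x0 orbF.
Qed.

End cdf.

(** * L-moments as integrals of K(F_0) *)

Section lmoment_identity.
Context {R : realType}.
Variable F0 : probability (measurableTypeR R) R.
Local Notation mu := (@lebesgue_measure R).
Local Notation F := (cdf_of F0).

(** K_r is Lipschitz and vanishes at 0 and at 1: compare K_r(F) with K_r(1) for x >= 0 and with
    K_r(0) for x < 0. *)
Lemma int_legendre_cdf_le_tail r : (2 <= r)%N -> exists2 C : R, 0 <= C &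
  forall x, `|int_legendre r (F x)| <= C * cdf_tail F0 x.
Proof.
move=> r2; have [C C0 KC] := @int_legendre_lipschitz R r.
exists C => // x; have Fx := cdf_of_itv01 F0 x; have /andP[Fx0 Fx1] := Fx.
rewrite /cdf_tail; case: ifP => _.
- have := KC (F x) 1 Fx; rewrite int_legendre1// subr0 ler01 lexx distrC.
  by rewrite (@ger0_norm _ (1 - F x)) ?subr_ge0//; exact.
- have := KC (F x) 0 Fx; rewrite int_legendre0 !subr0 ler01 lexx (ger0_norm Fx0).
  exact.
Qed.

Lemma int_legendre_cdf_integrable r : (2 <= r)%N ->
  mu.-integrable setT (EFin \o cdf_tail F0) ->
  mu.-integrable setT (fun x => (int_legendre r (F x))%:E).
Proof.
move=> r2 itail; have [C C0 KC] := int_legendre_cdf_le_tail r2.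
apply: (@le_integrable _ _ _ mu _ measurableT _ (fun x => C%:E * (EFin \o cdf_tail F0) x)%E).
- apply/measurable_EFinP; apply: int_legendre_comp_measurable.
    exact: cdf_of_measurable.
  exact: cdf_of_itv01.
- move=> x _; rewrite lee_fin (le_trans (KC x))//.
  by rewrite ger0_norm// mulr_ge0// cdf_tail_ge0.
- exact: integrableZl.
Qed.

(** Writes a real of either sign as an integral of indicators, at most one of the two intervals
    being nonempty. With [q] a quantile, this opens the way to Fubini. *)
Lemma integral_indic_signed (q c : R) :
  (\int[mu]_x ((\1_`[0%R, q[ x - \1_`[q, 0%R[ x) * c)%:E = (c * q)%:E)%E.
Proof.
have [q0|q0] := leP 0 q.
- rewrite (_ : (fun x => _) = (fun x => c%:E * (\1_`[0%R, q[ x)%:E)%E); last first.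
    apply/funext => x; rewrite (_ : `[q, 0[%classic = set0) ?indic0.
      by rewrite /= subr0 -EFinM mulrC.
    apply/seteqP; split => y //=; rewrite in_itv/= => /andP[qy].
    by move=> /(le_lt_trans qy); rewrite ltNge q0.
  rewrite integralZl//; last exact: integrable_indic_itv.
  rewrite integral_indic//= setIT lebesgue_measure_itv/= lte_fin.
  by case: ltgtP q0 => //= [_ _|<- _]; rewrite ?sube0 // mule0 mulr0.
- rewrite (_ : (fun x => _) = (fun x => (- c)%:E * (\1_`[q, 0%R[ x)%:E)%E); last first.
    apply/funext => x; rewrite (_ : `[0, q[%classic = set0) ?indic0.
      by rewrite /= sub0r -EFinM !mulNr mulrC.
    apply/seteqP; split => y //=; rewrite in_itv/= => /andP[qy].
    by move=> /(le_lt_trans qy); rewrite ltNge (ltW q0).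
  rewrite integralZl//; last exact: integrable_indic_itv.
  rewrite integral_indic//= setIT lebesgue_measure_itv/= lte_fin q0.
  by rewrite -EFinB sub0r -EFinM mulrNN.
Qed.

Lemma integral_indic_signed_abs (q c : R) :
  (\int[mu]_x `|((\1_`[0%R, q[ x - \1_`[q, 0%R[ x) * c)%:E| = (`|c * q|)%:E)%E.
Proof.
(* [e] is the sign of [c * q]; the absolute value of the integrand is the same integrand with
   [e * c] for [c]. *)
pose e : R := if 0 <= c * q then 1 else - 1.
rewrite (_ : `|c * q| = e * c * q); last first.
  rewrite /e; case: ifPn => [h|]; first by rewrite ger0_norm// mul1r.
  by rewrite -ltNge => h; rewrite ltr0_norm// mulN1r mulNr.
rewrite -integral_indic_signed; apply: eq_integral => x _; rewrite abse_EFin; congr EFin.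
rewrite !indicE !mem_setE !in_itv/= /e.
case: (leP 0 x) => x0 /=; rewrite ?andbT ?andbF ?subr0 ?sub0r.
- case: (ltP x q) => xq; rewrite ?mul0r ?normr0// !mul1r.
  have q0 := le_lt_trans x0 xq.
  rewrite pmulr_lge0//; case: ifPn => [h|]; first by rewrite ger0_norm// mul1r.
  by rewrite -ltNge => h; rewrite ltr0_norm// mulN1r.
- case: (leP q x) => xq; rewrite ?oppr0 ?mul0r ?normr0// !mulN1r.
  have q0 := le_lt_trans xq x0.
  rewrite nmulr_lge0//; case: ifPn => [h|]; first by rewrite normrN ler0_norm// mul1r.
  by rewrite -ltNge => h; rewrite normrN gtr0_norm// mulN1r opprK.
Qed.

(** The inner integral over u in Fubini. For x >= 0 it is K(1) - K(F x) with K(1) = 0; for x < 0 it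
    is minus the integral of L from 0 to F x. *)
Lemma int_legendre_cdf_section r x : (2 <= r)%N ->
  let A := [set u | [/\ 0 < u < 1, 0 <= x & F x < u]] in
  let B := [set u | [/\ 0 < u < 1, x < 0 & u <= F x]] in
  (\int[mu]_u ((\1_A u - \1_B u) * shifted_legendre r.-1 u)%:E
    = (- int_legendre r (F x))%:E)%E.
Proof.
move=> r2 A B; set L := shifted_legendre r.-1.
have cL : continuous L := @shifted_legendre_continuous R r.-1.
have iL a b : mu.-integrable `[a, b] (EFin \o L) by exact: continuous_segment_integrable.
have /andP[Fx0 Fx1] := cdf_of_itv01 F0 x.
have key (D : set R) : measurable D -> D `<=` `[0, 1]%classic ->
    (\int[mu]_u (\1_D u * L u)%:E = (\int[mu]_(u in D) L u)%:E)%E.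
  move=> mD D01; rewrite /Rintegral fineK; last first.
    by apply: integrable_fin_num => //; apply: integrableS (iL 0 1).
  rewrite [RHS]integral_mkcond; apply: eq_integral => u _.
  rewrite patchE indicE; case: ifP; rewrite ?mul1r ?mul0r//.
have [x0|x0] := leP 0 x.
- rewrite (_ : B = set0); last by apply/seteqP; split => u //= -[_]; rewrite ltNge x0.
  rewrite (_ : A = `]F x, 1[%classic); last first.
    apply/seteqP; split => u /=; rewrite in_itv/=.
      by case=> /andP[_ ->] _ ->.
    move=> /andP[Fu u1]; split => //; by rewrite u1 (le_lt_trans Fx0 Fu).
  under eq_integral do rewrite indic0 subr0.
  rewrite key//; last first.
    by move=> u /=; rewrite !in_itv/= => /andP[Fu /ltW->]; rewrite (le_trans Fx0 (ltW Fu)).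
  congr EFin; rewrite Rintegral_itv_bndo_bndc; last first.
    apply: integrableS (iL (F x) 1) => //.
    by apply: subset_itv; rewrite bnd_simp.
  rewrite -(@Rintegral_itvB _ L (BLeft 0)) ?bnd_simp//.
  by rewrite -/(@int_legendre R r 1) int_legendre1// sub0r.
- rewrite (_ : A = set0); last first.
    by apply/seteqP; split => u //= -[_]; rewrite leNgt x0.
  under eq_integral do rewrite indic0 sub0r.
  have EB : (\int[mu]_u (\1_B u * L u)%:E = (int_legendre r (F x))%:E)%E.
    have KF y : 0 <= y -> \int[mu]_(u in `]0, y]) L u = int_legendre r y.
      move=> y0; rewrite Rintegral_itv_obnd_cbnd//.
      by apply: integrableS (iL 0 y) => //; apply: subset_itv; rewrite bnd_simp.
    have [F1|F1] := ltP (F x) 1.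
    + rewrite (_ : B = `]0, F x]%classic); last first.
        apply/seteqP; split => u /=; rewrite in_itv/=.
          by case=> /andP[-> _] _ ->.
        move=> /andP[u0 uF]; split => //; by rewrite u0 (le_lt_trans uF F1).
      rewrite key ?KF//.
      by move=> u /=; rewrite !in_itv/= => /andP[/ltW-> uF]; rewrite (le_trans uF).
    + have F1' : F x = 1 by apply/eqP; rewrite eq_le Fx1.
      rewrite (_ : B = `]0, 1[%classic); last first.
        apply/seteqP; split => u /=; rewrite in_itv/=; first by case.
        move=> /[dup] u01 /andP[_ u1]; split => //; by rewrite F1' ltW.
      rewrite key//; last first.
        by move=> u /=; rewrite !in_itv/= => /andP[/ltW-> /ltW->].
      rewrite F1' -(KF 1)// Rintegral_itv_bndo_bndc//.
      by apply: integrableS (iL 0 1) => //; apply: subset_itv; rewrite bnd_simp.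
  under eq_integral do rewrite mulNr EFinN.
  (* Negating the integral requires that the positive and negative parts be not both infinite, which
     the finite value in [EB] excludes. *)
  rewrite integralN ?EB//=; move: EB; rewrite integralE.
  by case: (integral _ _ _) => [a| |]; case: (integral _ _ _) => [b| |].
Qed.

(** Write the quantile Q(u) as an integral over x by [integral_indic_signed] and exchange the order
    of integration in L(u) Q(u). *)
Lemma lmoment_int_legendre r : (2 <= r)%N ->
  mu.-integrable setT (fun x => (int_legendre r (F x))%:E) ->
  mu.-integrable `]0, 1[ (fun u => (shifted_legendre r.-1 u * quantile F u)%:E) ->
  \int[mu]_(u in `]0, 1[) (shifted_legendre r.-1 u * quantile F u) =
  - \int[mu]_x int_legendre r (F x).
Proof.
move=> r2 iK iLQ; set L := shifted_legendre r.-1 in iLQ *.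
pose M := measurableTypeR R.
(* Stated through [F], the sets [A] and [B] are visibly measurable in (u, x); by [quantile_le] they
   are 0 <= x < Q(u) and Q(u) <= x < 0, for 0 < u < 1. *)
pose A := [set p : M * M | [/\ 0 < (p.1 : R) < 1, 0 <= (p.2 : R) & F p.2 < p.1]].
pose B := [set p : M * M | [/\ 0 < (p.1 : R) < 1, (p.2 : R) < 0 & p.1 <= F p.2]].
pose f (p : M * M) : \bar R := ((\1_A p - \1_B p) * L p.1)%:E.
have m1 : measurable_fun [set: M * M] (fun p : M * M => (p.1 : R)) := measurable_fst.
have m2 : measurable_fun [set: M * M] (fun p : M * M => (p.2 : R)) := measurable_snd.
have mF2 : measurable_fun [set: M * M] (fun p : M * M => F p.2).
  by apply: (measurableT_comp (cdf_of_measurable F0)).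
have mA : measurable A.
  pose b (p : M * M) := ((0 < (p.1 : R)) && ((p.1 : R) < 1)) &&
    ((0 <= (p.2 : R)) && (F p.2 < (p.1 : R))).
  rewrite (_ : A = setT `&` b @^-1` [set true]); last first.
    rewrite setTI; apply/seteqP; split => p; rewrite /A /b /=.
      by case=> -> -> ->.
    by move=> /andP[-> /andP[-> ->]].
  suff mb : measurable_fun setT b by exact: mb.
  by do 2?apply: measurable_and; (apply: measurable_fun_ltr || apply: measurable_fun_ler) => //;
    exact: measurable_cst.
have mB : measurable B.
  pose b (p : M * M) := ((0 < (p.1 : R)) && ((p.1 : R) < 1)) &&
    (((p.2 : R) < 0) && ((p.1 : R) <= F p.2)).
  rewrite (_ : B = setT `&` b @^-1` [set true]); last first.
    rewrite setTI; apply/seteqP; split => p; rewrite /B /b /=.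
      by case=> -> -> ->.
    by move=> /andP[-> /andP[-> ->]].
  suff mb : measurable_fun setT b by exact: mb.
  by do 2?apply: measurable_and; (apply: measurable_fun_ltr || apply: measurable_fun_ler) => //;
    exact: measurable_cst.
have mf : measurable_fun setT f.
  apply/measurable_EFinP; apply: measurable_funM.
    by apply: measurable_funB; exact: measurable_indic.
  apply: (measurableT_comp _ m1); apply: continuous_measurable_fun.
  exact: shifted_legendre_continuous.
have fE u x : f (u, x) = if 0 < u < 1 then ((\1_`[0, quantile F u[ x -
   \1_`[quantile F u, 0[ x) * L u)%:E else 0%E.
  rewrite /f !indicE !mem_setE /=; case: ifPn => u01.
    have -> : ((u, x) \in A) = (x \in `[0, quantile F u[).
      rewrite in_itv/= ltNge quantile_le// -ltNge; apply/idP/idP.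
        by rewrite inE /A/= => -[_ -> ->].
      by rewrite inE /A/= => /andP[-> ->].
    have -> // : ((u, x) \in B) = (x \in `[quantile F u, 0[).
    rewrite in_itv/= quantile_le//; apply/idP/idP.
      by rewrite inE /B/= => -[_ -> ->].
    by rewrite inE /B/= => /andP[-> ->].
  by rewrite !memNset ?subr0 ?mul0r//; move=> -[]; rewrite (negbTE u01).
have fx u : (\int[mu]_x f (u, x))%E =
    ((fun v => (L v * quantile F v)%:E) \_ `]0, 1[%classic) u.
  under eq_integral do rewrite fE.
  rewrite patchE mem_setE in_itv/=; case: ifPn => u01.
    by rewrite integral_indic_signed.
  by rewrite integral0.
have afx u : (\int[mu]_x `|f (u, x)|)%E =
    ((fun v => `|(L v * quantile F v)%:E|%E) \_ `]0, 1[%classic) u.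
  under eq_integral do rewrite fE.
  rewrite patchE mem_setE in_itv/=; case: ifPn => u01.
    by rewrite integral_indic_signed_abs.
  by under eq_integral do rewrite abse0; rewrite integral0.
(* The iterated integral of |f| is the integral of |L Q|, finite by [iLQ]. *)
have fi : (mu \x mu)%E.-integrable setT f.
  apply/integrable12ltyP => //; under eq_integral do rewrite afx.
  by rewrite -integral_mkcond; case/integrableP: iLQ.
have := @Fubini _ _ _ _ _ mu mu f fi.
under eq_integral do rewrite fx.
rewrite -integral_mkcond /Rintegral => ->.
transitivity (fine (\int[mu]_x (- int_legendre r (F x))%:E)%E).
  congr fine; apply: eq_integral => x _.
  by rewrite -(int_legendre_cdf_section x r2).
rewrite -fineN -integralN; last exact: integrable_add_def iK.
by congr fine; apply: eq_integral => x _; rewrite EFinN.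
Qed.

End lmoment_identity.

(** * The divergence as a function of the moments *)

Section divergence_bounds.
Context {R : realType}.
Variables (phi : R -> \bar R) (a b : \bar R).
Hypothesis phi_ge0 : forall x, (0 <= phi x)%E.
Hypothesis phi_convex : strictly_convex phi.
Hypothesis phi1 : phi 1 = 0%E.

Lemma phi_segment y t : (phi y < +oo)%E -> 0 < t < 1 ->
  (phi (t * y + (1 - t))%R <= t%:E * phi y)%E.
Proof.
move=> phiy t01; have [->|y1] := eqVneq y 1.
  by rewrite mulr1 addrC subrK phi1 mule0.
have := phi_convex phiy _ y1 t01; rewrite phi1 ltry => /(_ isT).
by rewrite mulr1 mule0 adde0 => /ltW.
Qed.

(** The coefficient 1, instead of [1 - t], in front of [phi x] lets the bound integrate to the
    unperturbed divergence plus an error of order [t], without scaling a possibly nonmeasurable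
    integrand. *)
Lemma phi_convex_le x y t : (phi y < +oo)%E -> 0 < t < 1 ->
  (phi ((1 - t) * x + t * y)%R <= phi x + t%:E * phi y)%E.
Proof.
move=> phiy t01; have /andP[t0 t1] := t01.
have [->|phix] := eqVneq (phi x) +oo%E.
  rewrite addye ?leey// gt_eqF// (@lt_le_trans _ _ 0%E)// mule_ge0//.
  by rewrite lee_fin ltW.
have phix' : (phi x < +oo)%E by rewrite ltey.
have [->|xy] := eqVneq x y.
  rewrite -mulrDl subrK mul1r leeDl// mule_ge0// lee_fin ltW//.
have t01' : 0 < 1 - t < 1 by rewrite subr_gt0 t1/= ltrBlDr ltrDl.
have := phi_convex phix' phiy xy t01'; rewrite subKr => /ltW/le_trans; apply.
apply: leeD => //; have fx : phi x \is a fin_num by rewrite ge0_fin_numE.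
rewrite -(fineK fx) -EFinM lee_fin ler_piMl ?fine_ge0//.
by rewrite gerBl ltW.
Qed.

Hypotheses (a_lt1 : (a < 1%:E)%E) (b_gt1 : (1%:E < b)%E).
Hypothesis phi_dom : [set x | (phi x < +oo)%E] = [set x : R | (a < x%:E < b)%E].

Lemma phi_finite_near : exists2 delta : R, 0 < delta &
  (phi (1 + delta) < +oo)%E /\ (phi (1 - delta) < +oo)%E.
Proof.
have [da da0 aa] : exists2 da : R, 0 < da & forall e, 0 < e -> e <= da -> (a < (1 - e)%:E)%E.
  case: a a_lt1 => [a'| |]//=.
    rewrite lte_fin => a'1; exists ((1 - a') / 2); first by lra.
    by move=> e e0 ea; rewrite lte_fin; lra.
  by move=> _; exists 1 => // e _ _; rewrite ltNyr.
have [db db0 bb] : exists2 db : R, 0 < db & forall e, 0 < e -> e <= db -> ((1 + e)%:E < b)%E.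
  case: b b_gt1 => [b'| |]//=.
    rewrite lte_fin => b'1; exists ((b' - 1) / 2); first by lra.
    by move=> e e0 ea; rewrite lte_fin; lra.
  by move=> _; exists 1 => // e _ _; rewrite ltry.
pose e := Num.min da db.
have e0 : 0 < e by rewrite lt_min da0.
have domP x : (a < x%:E < b)%E -> (phi x < +oo)%E.
  by move=> xab; have : [set x : R | (a < x%:E < b)%E] x by []; rewrite -phi_dom.
exists e => //; split; apply: domP.
- rewrite bb ?ge_min ?lexx ?orbT// andbT (lt_trans a_lt1)// lte_fin; lra.
- rewrite aa ?ge_min ?lexx//= (lt_trans _ b_gt1)// lte_fin; lra.
Qed.

(** For |h| <= e, the point 1 + h lies at proportion |h| / e between 1, where [phi] vanishes, and
    one of the points 1 + e, 1 - e. Adding the values at both points gives one slope for both signs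
    of h. *)
Lemma phi_le_linear : exists delta M : R, [/\ 0 < delta, 0 <= M &
  forall h, `|h| <= delta -> (phi (1 + h) <= (M * `|h|)%:E)%E].
Proof.
have [e e0 [pp pm]] := phi_finite_near.
pose M := (fine (phi (1 + e)) + fine (phi (1 - e))) / e.
have fp : phi (1 + e) \is a fin_num by rewrite ge0_fin_numE.
have fm : phi (1 - e) \is a fin_num by rewrite ge0_fin_numE.
have p0 x : 0 <= fine (phi x) by rewrite fine_ge0.
exists e, M; split => // [|h he]; first by rewrite divr_ge0 ?addr_ge0// ltW.
have [->|h0] := eqVneq h 0; first by rewrite addr0 phi1 normr0 mulr0.
pose t := `|h| / e.
have t0 : 0 < t by rewrite divr_gt0// normr_gt0.
have Mh : M * `|h| = t * (fine (phi (1 + e)) + fine (phi (1 - e))).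
  by rewrite /M /t; field; rewrite gt_eqF.
have {he} : t <= 1 by rewrite ler_pdivrMr// mul1r.
have key (y : R) : phi y \is a fin_num -> 1 + h = t * y + (1 - t) -> t <= 1 ->
    (phi (1 + h) <= (t * fine (phi y))%:E)%E.
  move=> fy -> ; rewrite EFinM fineK// le_eqVlt => /predU1P[->|t1].
    by rewrite subrr addr0 !mul1r mul1e.
  by apply: phi_segment; [rewrite -ge0_fin_numE|rewrite t0].
have ht : `|h| = t * e by rewrite /t mulfVK// gt_eqF.
have [h0'|h0'] := leP 0 h; move=> t1.
- apply: (le_trans (key _ fp _ t1)).
    by rewrite -[in LHS](ger0_norm h0') ht; ring.
  by rewrite lee_fin Mh ler_wpM2l ?(ltW t0)// lerDl.
- apply: (le_trans (key _ fm _ t1)).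
    by rewrite -[in LHS](opprK h) -(ltr0_norm h0') ht; ring.
  by rewrite lee_fin Mh ler_wpM2l ?(ltW t0)// lerDr.
Qed.

Lemma phi_gt0 x : x != 1 -> (0 < phi x)%E.
Proof.
move=> x1; rewrite lt0e phi_ge0 andbT; apply/eqP => phix.
have h : 0 < (2^-1 : R) < 1 by apply/andP; split; lra.
have := @phi_convex x 1 2^-1 _ _ x1 h; rewrite phix phi1 !ltry => /(_ isT isT).
by rewrite !mule0 adde0 ltNge phi_ge0.
Qed.

(** By strict convexity [phi] is positive at distance [h0] from 1, and chords issued from 1 get
    steeper further away. Within distance [h0] the term [c * h0] suffices. *)
Lemma phi_ge_linear h0 : 0 < h0 -> exists2 c : R, 0 < c &
  forall h, ((c * `|h|)%:E <= (c * h0)%:E + phi (1 + h)%R)%E.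
Proof.
move=> h00.
have [e e0 [pp pm]] := phi_finite_near.
(* [phi] may be infinite at 1 + s; the real number 1 is then the lower bound. *)
have fine_far s : s != 0 -> exists2 p : R, 0 < p & (p%:E <= phi (1 + s))%E.
  move=> s0; have : (0 < phi (1 + s))%E.
    by apply: phi_gt0; rewrite -subr_eq0 addrC addKr.
  by case: (phi (1 + s)) => [p| |]//; [rewrite lte_fin; exists p|exists 1; rewrite ?leey].
have [p p0 php] := fine_far h0 (lt0r_neq0 h00).
have [q q0 phq] := fine_far (- h0) (ltr0_neq0 (ltac:(by rewrite oppr_lt0) : - h0 < 0)).
pose m := Num.min p q; have m0 : 0 < m by rewrite lt_min p0.
exists (m / h0); first by rewrite divr_gt0.
move=> h; have [hh|hh] := leP `|h| h0.
  apply: (@le_trans _ _ (m / h0 * h0)%:E); last by rewrite leeDl.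
  by rewrite lee_fin ler_wpM2l// divr_ge0// ltW.
have ch0 : (0 <= (m / h0 * h0)%:E)%E by rewrite lee_fin mulr_ge0 ?divr_ge0// ltW.
apply: (@le_trans _ _ (phi (1 + h))); last by rewrite leeDr.
have [->|phih] := eqVneq (phi (1 + h)) +oo%E; first by rewrite leey.
have hn0 : 0 < `|h| := lt_trans h00 hh.
pose t := h0 / `|h|.
have t01 : 0 < t < 1 by rewrite divr_gt0//= ltr_pdivrMr// mul1r.
have phihy : (phi (1 + h) < +oo)%E by rewrite ltey.
have := phi_segment phihy t01.
have -> : t * (1 + h) + (1 - t) = 1 + t * h by ring.
have mt : (m%:E <= phi (1 + t * h))%E.
  have [h0'|h0'] := leP 0 h.
    have -> : t * h = h0 by rewrite /t ger0_norm// mulfVK// -normr_gt0.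
    by apply: le_trans php; rewrite lee_fin ge_min lexx.
  have -> : t * h = - h0 by rewrite /t ltr0_norm// invrN mulrN mulNr mulfVK// -normr_gt0.
  by apply: le_trans phq; rewrite lee_fin ge_min lexx orbT.
move=> /(le_trans mt); have fh : phi (1 + h) \is a fin_num by rewrite ge0_fin_numE.
rewrite -(fineK fh) -EFinM !lee_fin /t => H.
rewrite mulrAC ler_pdivrMr//.
have := ler_wpM2r (ltW hn0) H.
by rewrite mulrAC mulfVK ?gt_eqF// [leRHS]mulrC.
Qed.

End divergence_bounds.

Lemma ae_lebesgueS (R : realType) (P Q : R -> Prop) : (forall x, P x -> Q x) ->
  {ae @lebesgue_measure R, forall x, P x} -> {ae @lebesgue_measure R, forall x, Q x}.
Proof.
by move=> PQ; apply: filterS => //; exact: (ae_filter_ringOfSetsType lebesgue_measure).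
Qed.

Lemma ae_lebesgueS2 (R : realType) (P Q S : R -> Prop) :
  (forall x, P x -> Q x -> S x) -> {ae @lebesgue_measure R, forall x, P x} ->
  {ae @lebesgue_measure R, forall x, Q x} -> {ae @lebesgue_measure R, forall x, S x}.
Proof.
by move=> PQS; apply: filterS2 => //; exact: (ae_filter_ringOfSetsType lebesgue_measure).
Qed.

(** * Infimum of the divergence under moment constraints *)

Section moment_constraint.
Context {R : realType} {l : nat}.
Local Notation mu := (@lebesgue_measure R).
Implicit Types (k : 'I_l -> R -> R) (v : 'cV[R]_l) (phi : R -> \bar R).

(** [Lsec] with general weights [k] for K(F) and a free target [v] for f(theta): the parameter
    enters only through [v], over which the bounds are proved. *)
Definition moment_class k v : set (R -> R) :=
  [set T : R -> R | {ae mu, forall x : R, derivable T x 1} /\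
    forall j,
      (\int[mu]_x `|k j x * derive1 T x|%:E < +oo)%E /\
      (\int[mu]_x (k j x * derive1 T x)%:E)%E = (v j ord0)%:E].

Definition moment_divergence phi k v : \bar R :=
  ereal_inf [set (\int[mu]_x phi (derive1 T x))%E | T in moment_class k v].

Definition moments k : 'cV[R]_l := \col_j \int[mu]_x k j x.

Lemma moment_divergence_ge0 phi k v : (forall x, (0 <= phi x)%E) ->
  (0 <= moment_divergence phi k v)%E.
Proof.
by move=> phi0; apply: le_ereal_inf_tmp => _ [T _ <-]; apply: integral_ge0.
Qed.

(** Trades the derivative for a Borel version, for which linearity of the integral is available. *)
Lemma moment_class_borel k v T : (forall j, measurable_fun setT (k j)) ->
  moment_class k v T -> exists g : R -> R, [/\ measurable_fun setT g,
    {ae mu, forall x, derive1 T x = g x},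
    forall j, mu.-integrable setT (EFin \o (fun x => k j x * g x)) &
    forall j, \int[mu]_x (k j x * g x) = v j ord0].
Proof.
move=> mk [/derive1_ae_borel[g mg Tg] kT]; exists g; split => // j.
- have [kTy _] := kT j; apply/integrableP; split.
    by apply/measurable_EFinP; apply: measurable_funM => //; exact: mk.
  apply: le_lt_trans kTy; rewrite le_eqVlt; apply/orP; left; apply/eqP.
  by apply: ae_eq_lower_integral; apply: ae_lebesgueS Tg => x ->.
- have [_ kTv] := kT j; rewrite /Rintegral (_ : integral _ _ _ = (v j ord0)%:E)//.
  by rewrite -kTv; apply: ae_eq_lower_integral; apply: ae_lebesgueS Tg => x ->.
Qed.

Lemma borel_moment_class k v T g : (forall j, measurable_fun setT (k j)) ->
  {ae mu, forall x : R, derivable T x 1 /\ derive1 T x = g x} ->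
  (forall j, mu.-integrable setT (EFin \o (fun x => k j x * g x))) ->
  (forall j, \int[mu]_x (k j x * g x) = v j ord0) ->
  moment_class k v T.
Proof.
move=> mk Tg ikg kgv; split; first by apply: ae_lebesgueS Tg => x [].
move=> j; split.
- have /integrableP[_] := ikg j; apply: le_lt_trans; rewrite le_eqVlt.
  by apply/orP; left; apply/eqP/ae_eq_lower_integral; apply: ae_lebesgueS Tg => x [_ ->].
- rewrite -kgv /Rintegral fineK; last exact: (integrable_fin_num _ (ikg j)).
  by apply: ae_eq_lower_integral; apply: ae_lebesgueS Tg => x [_ ->].
Qed.

Lemma moment_divergence_moments phi k : phi 1 = 0%E ->
  (forall x, (0 <= phi x)%E) -> (forall j, measurable_fun setT (k j)) ->
  (forall j, mu.-integrable setT (EFin \o k j)) ->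
  moment_divergence phi k (moments k) = 0%E.
Proof.
move=> phi1 phi0 mk ik; apply/eqP; rewrite eq_le moment_divergence_ge0// andbT.
apply: ereal_inf_lbound; exists id.
  apply: (@borel_moment_class _ _ _ (cst 1)) => //.
  - by apply: aeW => x; rewrite derive1E derive_id.
  - by move=> j; under eq_fun do rewrite mulr1; exact: ik.
  - by move=> j; rewrite mxE; apply: eq_Rintegral => x _; rewrite mulr1.
rewrite integral0_eq// => x _.
by rewrite derive1E derive_id.
Qed.

Section bounds.
Variables (phi : R -> \bar R) (a b : \bar R).
Hypothesis phi_ge0 : forall x, (0 <= phi x)%E.
Hypothesis phi_convex : strictly_convex phi.
Hypothesis phi1 : phi 1 = 0%E.
Hypotheses (a_lt1 : (a < 1%:E)%E) (b_gt1 : (1%:E < b)%E).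
Hypothesis phi_dom : [set x | (phi x < +oo)%E] = [set x : R | (a < x%:E < b)%E].

(** A moment off by [rho] forces the integral of |k_j| |g - 1| to be at least [rho]. The lower bound
    on [phi] is multiplied by the weight |k_j| / C <= 1, which makes its constant term integrable
    over the line. The result depends on [k] only through [C] and [B]. *)
Lemma moment_divergence_lower (C B rho : R) : 0 < C -> 0 <= B -> 0 < rho ->
  exists2 c : R, 0 < c & forall k v,
    (forall j, mu.-integrable setT (EFin \o k j)) ->
    (forall j x, `|k j x| <= C) ->
    (forall j, \int[mu]_x `|k j x| <= B) ->
    (exists j, rho <= `|v j ord0 - moments k j ord0|) ->
    (c%:E <= moment_divergence phi k v)%E.
Proof.
(* Chosen so that [h0 * B <= rho / 2]: the constant term of the linear bound costs at most half of
   [rho]. The added 1 covers [B = 0]. *)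
move=> C0 B0 rho0; pose h0 := rho / (2 * (B + 1)).
have B1 : 0 < B + 1 by lra.
have h00 : 0 < h0 by rewrite divr_gt0// mulr_gt0.
have [c c0 phic] := phi_ge_linear phi_ge0 phi_convex phi1 a_lt1 b_gt1 phi_dom h00.
exists (c / C * (rho / 2)); first by rewrite mulr_gt0// divr_gt0.
move=> k v ik kC kB [j vj]; apply: le_ereal_inf_tmp => _ [T kT <-].
have mk i : measurable_fun setT (k i).
  apply/measurable_EFinP. exact: (measurable_int mu (ik i)).
have [g [mg Tg ikg kgv]] := moment_class_borel mk kT.
have ikj : mu.-integrable setT (EFin \o (fun x => k j x * (g x - 1))).
  rewrite (_ : EFin \o _ =
      ((EFin \o (fun x => (k j x * g x)%R)) \- (EFin \o k j))%E).
    exact: (integrableB measurableT (ikg j) (ik j)).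
  by apply/funext => x /=; rewrite -EFinB; congr EFin; ring.
have rhoI : rho <= \int[mu]_x `|k j x * (g x - 1)|.
  apply: (le_trans vj); rewrite -kgv mxE -RintegralB//.
  under eq_Rintegral do rewrite -[X in _ - X]mulr1 -mulrBr.
  exact: le_normr_Rintegral.
have cC0 : 0 < c / C by rewrite divr_gt0.
have pointwise x : ((c / C * `|k j x * (g x - 1)|)%:E <=
    (c / C * h0 * `|k j x|)%:E + phi (g x))%E.
  have kjC : `|k j x| / C <= 1 by rewrite ler_pdivrMr// mul1r.
  have kj0 : 0 <= `|k j x| / C by rewrite divr_ge0// ltW.
  have := phic (g x - 1); rewrite [1 + _]addrC subrK.
  case: (phi (g x)) (phi_ge0 (g x)) => [p| |]//; last by rewrite addey ?leey.
  rewrite -!EFinD !lee_fin => p0 H; rewrite normrM.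
  have := ler_wpM2l kj0 H; have : `|k j x| / C * p <= p by rewrite ler_piMl.
  set u := `|k j x|; set w := `|g x - 1| => H1 H2.
  rewrite (_ : _ * (u * w) = u / C * (c * w)); last by ring.
  rewrite (_ : _ * u = u / C * (c * h0)); last by ring.
  by apply: (le_trans H2); rewrite mulrDr lerD2l.
have -> : (\int[mu]_x phi (derive1 T x) = \int[mu]_x phi (g x))%E.
  by apply: ae_eq_lower_integral; apply: ae_lebesgueS Tg => x ->.
have ink : mu.-integrable setT (EFin \o (fun x => `|k j x|)) by exact: integrable_norm.
have inkj : mu.-integrable setT (EFin \o (fun x => `|k j x * (g x - 1)|)) by exact: integrable_norm.
have I1 : ((c / C * rho)%:E <= \int[mu]_x (c / C * `|k j x * (g x - 1)|)%:E)%E.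
  under eq_integral do rewrite EFinM.
  rewrite integralZl// EFinM lee_pmul2l// ?lte_fin//.
  apply: (@le_trans _ _ (\int[mu]_x `|k j x * (g x - 1)|)%:E); first by rewrite lee_fin.
  by rewrite /Rintegral fineK//; exact: integrable_fin_num.
have I2 : (\int[mu]_x (c / C * h0 * `|k j x|)%:E <= (c / C * h0 * B)%:E)%E.
  under eq_integral do rewrite EFinM.
  rewrite integralZl// [leRHS]EFinM lee_pmul2l// ?lte_fin ?(mulr_gt0 cC0 h00)//.
  apply: (@le_trans _ _ (\int[mu]_x `|k j x|)%:E); last by rewrite lee_fin.
  by rewrite /Rintegral fineK//; exact: integrable_fin_num.
have : ((c / C * rho)%:E <= (c / C * h0 * B)%:E + \int[mu]_x phi (g x))%E.
  apply: (le_trans I1); apply: (@le_trans _ _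
    (\int[mu]_x ((c / C * h0 * `|k j x|)%:E + phi (g x)))%E).
    apply: ge0_le_lower_integral => // x; rewrite lee_fin mulr_ge0 ?(ltW cC0)//.
  apply: (le_trans _ (leeD2r _ I2)); apply: lower_integralD_le => //.
    by move=> x; rewrite mulr_ge0// ltW// mulr_gt0.
  by apply: measurable_funM => //; apply: measurableT_comp => //; exact: mk.
have h0B : h0 * B <= rho / 2.
  rewrite /h0 invfM mulrA -mulrA ler_piMr// ?divr_ge0 ?(ltW rho0)//.
  by rewrite mulrC ler_pdivrMr// mul1r lerDl.
rewrite -leeBlDl// -EFinB; apply: le_trans; rewrite lee_fin -(mulrA _ h0) -mulrBr.
by rewrite ler_wpM2l ?(ltW cC0)//; lra.
Qed.

End bounds.

End moment_constraint.

(** Lebesgue differentiation supplies a [T] with prescribed derivative 1 + h. *)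
Lemma primitive_ae_derive1 (R : realType) (h : R -> R) :
  (@lebesgue_measure R).-integrable setT (EFin \o h) ->
  {ae @lebesgue_measure R, forall x,
    derivable (fun y : R => y + \int[@lebesgue_measure R]_(t in [set` `]-oo, y]]) h t) x 1 /\
    derive1 (fun y : R => y + \int[@lebesgue_measure R]_(t in [set` `]-oo, y]]) h t) x = 1 + h x}.
Proof.
move=> ih; have ihy y : (@lebesgue_measure R).-integrable `]-oo, y] (EFin \o h).
  by apply: integrableS ih.
have := FTC1Ny ihy (open_integrable_locally openT ih).
apply: ae_lebesgueS => x [dH H'].
have dy : derivable (@id R) x 1 by [].
split; first exact: derivableD.
by rewrite derive1E deriveD// derive_id -derive1E H'.
Qed.

(** * Upper bound by perturbation of a feasible function *)

Section perturbation.
Context {R : realType} {l : nat}.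
Local Notation mu := (@lebesgue_measure R).
Variables (phi : R -> \bar R) (delta M : R).
Hypothesis phi_ge0 : forall x, (0 <= phi x)%E.
Hypothesis phi_convex : strictly_convex phi.
Hypothesis M0 : 0 <= M.
Hypothesis phi_lin : forall h, `|h| <= delta -> (phi (1 + h) <= (M * `|h|)%:E)%E.

Variables (k : 'I_l -> R -> R) (C : R).
Hypothesis ik : forall j, mu.-integrable setT (EFin \o k j).
Hypothesis kC : forall j x, `|k j x| <= C.

Let mk j : measurable_fun setT (k j).
Proof. by apply/measurable_EFinP; exact: (measurable_int mu (ik j)). Qed.

Let ikM j h : mu.-integrable setT (EFin \o h) ->
  mu.-integrable setT (EFin \o (fun x => k j x * h x)).
Proof.
move=> ih; have mh : measurable_fun setT h.
  by apply/measurable_EFinP; exact: (measurable_int mu ih).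
apply: (@le_integrable _ _ _ mu _ measurableT _ (fun x => C%:E * (EFin \o h) x)%E).
- by apply/measurable_EFinP; apply: measurable_funM => //; exact: mk.
- move=> x _; rewrite lee_fin /= !normrM ler_wpM2r//.
  by rewrite (le_trans (kC j x))// ler_norm.
- exact: integrableZl.
Qed.

(** Take [S = (1 - t) T1 + t T2] with [T1] feasible for [u] and T2' = 1 + h, whose moments are
    [moments k + z]. Pointwise, phi(S') <= phi(T1') + t M |h|, and [lower_integralD_le] splits the
    integral. *)
Lemma moment_divergence_perturb (u z : 'cV[R]_l) (h : R -> R) (t : R) :
  mu.-integrable setT (EFin \o h) -> (forall x, `|h x| <= delta) ->
  (forall j, \int[mu]_x (k j x * h x) = z j ord0) -> 0 < t < 1 ->
  (moment_divergence phi k ((1 - t) *: u + t *: (moments k + z)) <=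
   moment_divergence phi k u + (t * (M * \int[mu]_x `|h x|))%:E)%E.
Proof.
move=> ih hd khz t01; have /andP[t0 t1] := t01.
rewrite -leeBlDr//; apply: le_ereal_inf_tmp => _ [T1 kT1 <-]; rewrite leeBlDr//.
have [g [mg T1g ikg kgu]] := moment_class_borel mk kT1.
have [dT1 _] := kT1.
have dT2 := primitive_ae_derive1 ih.
set T2 := (fun y => y + _) in dT2.
pose S : R -> R := (1 - t) *: T1 + t *: T2.
have dS : {ae mu, forall x, derivable S x 1 /\
    derive1 S x = (1 - t) * derive1 T1 x + t * (1 + h x)}.
  apply: (ae_lebesgueS2 _ dT1 dT2) => x d1 [d2 d2E]; split.
    by apply: derivableD; exact: derivableZ.
  rewrite derive1E deriveD; [|exact: derivableZ|exact: derivableZ].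
  by rewrite deriveZ// deriveZ// -!derive1E d2E.
have ikc j : mu.-integrable setT (EFin \o (fun x => k j x * ((1 - t) * g x + t * (1 + h x)))).
  rewrite (_ : EFin \o _ = (fun x => (1 - t)%:E * (EFin \o (fun x => (k j x * g x)%R)) x +
     (t%:E * (EFin \o k j) x + t%:E * (EFin \o (fun x => (k j x * h x)%R)) x))%E).
    apply: integrableD => //; first exact: integrableZl.
    by apply: integrableD => //; apply: integrableZl => //; exact: ikM.
  by apply/funext => x /=; rewrite -!EFinM -!EFinD; congr EFin; ring.
have kS : moment_class k ((1 - t) *: u + t *: (moments k + z)) S.
  apply: (@borel_moment_class _ _ _ _ _ (fun x => (1 - t) * g x + t * (1 + h x))) => //.
    by apply: (ae_lebesgueS2 _ dS T1g) => x [? ->] ->.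
  move=> j; rewrite !mxE -khz -kgu.
  transitivity (\int[mu]_x ((1 - t) * (k j x * g x) + (t * k j x + t * (k j x * h x)))).
    by apply: eq_Rintegral => x _; ring.
  have i1 : mu.-integrable setT (EFin \o (fun x => (1 - t) * (k j x * g x))).
    exact: (integrableZl measurableT (1 - t) (ikg j)).
  have i2 : mu.-integrable setT (EFin \o (fun x => t * k j x)).
    exact: (integrableZl measurableT t (ik j)).
  have i3 : mu.-integrable setT (EFin \o (fun x => t * (k j x * h x))).
    exact: (integrableZl measurableT t (ikM j ih)).
  have i23 : mu.-integrable setT (EFin \o (fun x => t * k j x + t * (k j x * h x))).
    exact: (integrableD measurableT i2 i3).
  by rewrite RintegralD// RintegralD// !RintegralZl//; [ring|exact: ikM].
apply: (@le_trans _ _ (\int[mu]_x phi (derive1 S x))%E).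
  by apply: ereal_inf_lbound; exists S.
apply: (@le_trans _ _ (\int[mu]_x ((t * (M * `|h x|))%:E + phi (derive1 T1 x)))%E).
  apply: ge0_ae_le_lower_integral => //.
    by move=> x; rewrite adde_ge0// lee_fin !mulr_ge0// ltW.
  apply: ae_lebesgueS dS => x [_ ->].
  have hx := phi_lin (hd x).
  have hfin : (phi (1 + h x) < +oo)%E by rewrite (le_lt_trans hx)// ltry.
  apply: (le_trans (phi_convex_le _ _ _ hfin t01)) => //.
  by rewrite addeC leeD2r// EFinM lee_pmul2l// lte_fin.
have mh : measurable_fun setT h.
  by apply/measurable_EFinP; exact: (measurable_int mu ih).
apply: (le_trans (lower_integralD_le _ _ _ _)) => //.
- by move=> x; rewrite !mulr_ge0// ltW.
- by do 2 (apply: measurable_funM => //); apply: measurableT_comp.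
- rewrite addeC leeD2l//.
  under eq_integral do rewrite mulrA EFinM.
  have inh : mu.-integrable setT (EFin \o (fun x => `|h x|)) by exact: integrable_norm.
  rewrite integralZl// mulrA [leRHS]EFinM lee_pmul// ?lee_fin ?mulr_ge0 ?(ltW t0)//.
    by apply: integral_ge0 => x _; rewrite lee_fin.
  by rewrite /Rintegral fineK//; exact: integrable_fin_num.
Qed.

End perturbation.

(** * Existence and localization of minimizers *)

Section arginf_localization.
Context {R : realType} {V : normedModType R}.
Variables (D : V -> \bar R) (v0 : V) (r M : R).
Hypotheses (r0 : 0 < r) (M0 : 0 <= M).
Hypothesis D_ge0 : forall v, (0 <= D v)%E.
Hypothesis Dv0 : D v0 = 0%E.
Hypothesis D_perturb : forall u z t, `|z| <= r -> 0 < t < 1 ->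
  (D ((1 - t) *: u + t *: (v0 + z))%R <= D u + (t * M)%:E)%E.

(** The segment from [u] through [v] is prolonged to a point [v0 + z], of which [v] is the
    combination with weight [t = 2 |v - u| / r]; then |z| <= r/2 + r/2 and the cost is [t * M]. *)
Lemma perturb_lipschitz u v : `|u - v0| <= r / 2 -> `|v - u| < r / 2 ->
  (D v <= D u + (2 * M / r * `|v - u|)%:E)%E.
Proof.
move=> uv0 vu; have [->|vu0] := eqVneq v u.
  by rewrite subrr normr0 mulr0 adde0.
have nvu : 0 < `|v - u| by rewrite normr_gt0 subr_eq0.
pose t := 2 * `|v - u| / r.
have t0 : 0 < t by rewrite divr_gt0// mulr_gt0.
have t01 : 0 < t < 1.
  by rewrite t0/= /t ltr_pdivrMr// mul1r mulrC -ltr_pdivlMr.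
pose z := (u - v0) + t^-1 *: (v - u).
have zr : `|z| <= r.
  apply: (le_trans (ler_normD _ _)).
  rewrite normrZ gtr0_norm ?invr_gt0//.
  have -> : t^-1 * `|v - u| = r / 2.
    by rewrite /t; field; rewrite !gt_eqF.
  by lra.
have -> : 2 * M / r * `|v - u| = t * M by rewrite /t; field; rewrite gt_eqF.
apply: le_trans (D_perturb u zr t01); rewrite le_eqVlt; apply/orP; left; apply/eqP.
congr D; rewrite /z addrA [v0 + _]addrC subrK scalerDr scalerA divff ?gt_eqF// scale1r.
by rewrite scalerBl scale1r addrA subrK addrC subrK.
Qed.

(** At [f x0] the criterion is below [c], while outside the ball of radius [rho] it is at least [c],
    so minimizers map into the ball. On the ball it is finite and continuous, hence attains its
    minimum over the compact part of the image of [Theta] lying there. *)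
Lemma arginf_localized (E : topologicalType) (Theta : set E) (f : E -> V)
    (x0 : E) (rho c : R) :
  compact Theta -> {within Theta, continuous f} -> Theta x0 ->
  0 < rho -> rho < r / 2 ->
  (forall v, rho <= `|v - v0| -> (c%:E <= D v)%E) ->
  `|f x0 - v0| < rho -> 2 * M / r * `|f x0 - v0| < c ->
  arginf Theta (D \o f) !=set0 /\
  forall x, arginf Theta (D \o f) x -> `|f x - v0| < rho.
Proof.
move=> cT cf Tx0 rho0 rhor far fx0 fx0c.
have near_lip v : `|v - v0| < r / 2 -> (D v <= (2 * M / r * `|v - v0|)%:E)%E.
  move=> vr; have := @perturb_lipschitz v0 v; rewrite subrr normr0 Dv0 add0e.
  by apply => //; rewrite divr_ge0// ltW.
have Dfx0 : (D (f x0) < c%:E)%E.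
  apply: le_lt_trans (near_lip _ _) _; last by rewrite lte_fin.
  exact: lt_trans rhor.
split; last first.
  move=> x [Tx xmin]; rewrite ltNge; apply/negP => /far.
  by rewrite leNgt (le_lt_trans (xmin _ Tx0) Dfx0).
have fin v : `|v - v0| <= rho -> D v \is a fin_num.
  move=> vr; rewrite ge0_fin_numE// (le_lt_trans (near_lip _ _)) ?ltry//.
  exact: le_lt_trans rhor.
pose B := [set v : V | `|v - v0| <= rho].
have cB : closed B.
  have -> : B = (fun v => `|v - v0|) @^-1` [set x | x <= rho] by [].
  apply: closed_comp; last exact: closed_le.
  move=> v _; apply: cvg_norm; apply: cvgB; [exact: cvg_id|exact: cvg_cst].
have cK : compact (f @` Theta `&` B).
  apply: compact_closedI => //; exact: continuous_compact.
have K0 : f @` Theta `&` B !=set0.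
  by exists (f x0); split; [exists x0|rewrite /B/=; exact: ltW].
have cD : {within f @` Theta `&` B, continuous (fine \o D)}.
  apply/subspace_continuousP => u [_ Bu].
  apply/cvgrPdist_le => e e0; rewrite near_withinE.
  pose L := 2 * M / r; have L0 : 0 <= L by rewrite divr_ge0 ?mulr_ge0// ltW.
  near=> v => -[_ Bv] /=.
  have uv1 : `|u - v| < r / 2.
    near: v; apply: (@cvgr_dist_lt _ _ _ _ (nbhs_filter u) id) => //.
    by rewrite divr_gt0.
  have uv2 : `|u - v| < e / (L + 1).
    near: v; apply: (@cvgr_dist_lt _ _ _ _ (nbhs_filter u) id) => //.
    by rewrite divr_gt0// ltr_wpDl.
  have Le : L * `|u - v| <= e.
    apply: (@le_trans _ _ (L * (e / (L + 1)))); first by rewrite ler_wpM2l// ltW.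
    rewrite mulrCA ler_piMr ?(ltW e0)// ler_pdivrMr ?ltr_wpDl// mul1r.
    by rewrite lerDl.
  have lip x y : B x -> B y -> `|x - y| < r / 2 -> fine (D x) - fine (D y) <= L * `|x - y|.
    move=> Bx By xy; rewrite lerBlDl -lee_fin EFinD !fineK ?fin//.
    by apply: perturb_lipschitz => //; exact: le_trans By (ltW rhor).
  rewrite ler_norml lerNl opprB (le_trans (lip _ _ Bv Bu _)) ?(distrC v)//=.
  by rewrite (le_trans (lip _ _ Bu Bv _)).
have [w] := compact_EVT_min K0 cK cD.
rewrite inE => -[[x Tx xw] Bw] wmin.
have Dwmin y : Theta y -> B (f y) -> (D w <= D (f y))%E.
  move=> Ty By; rewrite -[D w]fineK ?fin// -[D (f y)]fineK ?fin// lee_fin.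
  by apply: wmin; rewrite inE; split => //; exists y.
exists x; split => // y Ty; rewrite /= xw.
have [By|By] := leP `|f y - v0| rho; first exact: Dwmin.
apply: (@le_trans _ _ (D (f x0))); first by apply: Dwmin => //; exact: ltW.
by apply: (le_trans (ltW Dfx0)); apply: far; exact: ltW.
Unshelve. all: by end_near. Qed.

End arginf_localization.

(** On the compact set of points of [Theta] at distance at least [eps] from [x0], the distance from
    [f x] to [f x0] attains a minimum, positive by uniqueness; it serves as [eta]. *)
Lemma compact_unique_preimage_near (R : realType) (E V : normedModType R)
    (Theta : set E) (f : E -> V) (x0 : E) (eps : R) :
  compact Theta -> {within Theta, continuous f} ->
  (forall x, Theta x -> f x = f x0 -> x = x0) -> 0 < eps ->
  exists2 eta : R, 0 < eta &
    forall x, Theta x -> `|f x - f x0| < eta -> `|x - x0| < eps.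
Proof.
move=> cT cf uniq eps0.
pose A := Theta `&` [set x | eps <= `|x - x0|].
have cA : compact A.
  apply: compact_closedI => //.
  have -> : [set x | eps <= `|x - x0|] = (fun x => `|x - x0|) @^-1` [set x | eps <= x] by [].
  apply: closed_comp; last exact: closed_ge.
  move=> v _; apply: cvg_norm; apply: cvgB; [exact: cvg_id|exact: cvg_cst].
have [[x1 Ax1]|A0] := pselect (A !=set0); last first.
  exists 1 => // x Tx _; rewrite ltNge; apply/negP => xe.
  by apply: A0; exists x.
have cg : {within A, continuous (fun x => `|f x - f x0|)}.
  have cfA : {within A, continuous f} by apply: continuous_subspaceW cf => x [].
  move=> x; apply: cvg_norm; apply: cvgB; [exact: cfA|exact: cvg_cst].
have [w] := compact_EVT_min (ex_intro _ x1 Ax1) cA cg.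
rewrite inE => -[Tw we] wmin.
exists `|f w - f x0|.
  rewrite normr_gt0 subr_eq0; apply/eqP => /(uniq _ Tw) wx0.
  by move: we; rewrite /= wx0 subrr normr0 leNgt eps0.
move=> x Tx; rewrite !ltNge; apply: contra => xe; apply: wmin.
by rewrite inE.
Qed.

(** * Uniform invertibility near an invertible matrix *)

Section matrix_stability.
Context {R : realType}.

Lemma mx_entry_le_norm m n (x : 'M[R]_(m, n)) i j : `|x i j| <= `|x|.
Proof.
rewrite [leRHS]/Num.norm/= mx_normrE.
exact: (le_bigmax _ (fun ij : 'I_m * 'I_n => `|x ij.1 ij.2|) (i, j)).
Qed.

Lemma mx_norm_attained m n (x : 'M[R]_(m, n)) : 0 < `|x| ->
  exists i j, `|x| = `|x i j|.
Proof.
move=> x0; have [|[i j] /= xij] := @mx_norm_neq0 _ _ _ x; first by rewrite gt_eqF.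
by exists i, j.
Qed.

Lemma mx_norm_leP m n (x : 'M[R]_(m, n)) c : 0 <= c ->
  (forall i j, `|x i j| <= c) -> `|x| <= c.
Proof.
move=> c0 xc; have [->|x0] := eqVneq x 0; first by rewrite normr0.
by have [|i [j ->]] := @mx_norm_attained _ _ x; rewrite ?normr_gt0.
Qed.

Lemma mulmx_norm_le m n (N : 'M[R]_(m, n)) (x : 'cV[R]_n) :
  `|N *m x| <= n%:R * `|N| * `|x|.
Proof.
apply: mx_norm_leP => [|i j]; first by rewrite !mulr_ge0.
rewrite mxE (le_trans (ler_norm_sum _ _ _))//.
apply: (@le_trans _ _ (\sum_(k < n) `|N| * `|x|)); last first.
  by rewrite sumr_const card_ord -(mulr_natl (_ * _)) mulrA.
by apply: ler_sum => k _; rewrite normrM ler_pM// mx_entry_le_norm.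
Qed.

(** With W the inverse of A, x = W (A' x) - W ((A' - A) x). [kappa] makes the last term at most |x|
    / 2, whence |x| <= 2 w |A' x|: this yields both the injectivity of A' and the bound on its
    inverse. *)
Lemma unitmx_stable l (A : 'M[R]_l) : A \in unitmx ->
  exists kappa Lambda : R, [/\ 0 < kappa, 0 <= Lambda &
    forall A' : 'M[R]_l, `|A' - A| <= kappa ->
    forall z : 'cV[R]_l, exists x : 'cV[R]_l, A' *m x = z /\ `|x| <= Lambda * `|z|].
Proof.
move=> uA; pose W := invmx A; pose w := l%:R * `|W| : R.
have w0 : 0 <= w by rewrite mulr_ge0.
pose kappa := (2 * (w * l%:R + 1))^-1.
have d0 : 0 < w * l%:R + 1 by rewrite ltr_wpDl// mulr_ge0.
exists kappa, (2 * w); split; [by rewrite invr_gt0 mulr_gt0|by rewrite mulr_ge0|].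
move=> A' AA'.
have key (x : 'cV[R]_l) : `|x| <= 2 * w * `|A' *m x|.
  have xE : x = W *m (A' *m x) - W *m ((A' - A) *m x).
    rewrite -mulmxBr -mulmxBl opprB addrCA subrr addr0 mulmxA mulVmx//.
    by rewrite mul1mx.
  have H1 : `|x| <= w * `|A' *m x| + w * `|(A' - A) *m x|.
    rewrite {1}xE (le_trans (ler_normB _ _))// lerD// mulmx_norm_le//.
  have H2 : `|(A' - A) *m x| <= l%:R * kappa * `|x|.
    apply: (le_trans (mulmx_norm_le _ _)).
    by rewrite ler_wpM2r// ler_wpM2l.
  have H3 : w * (l%:R * kappa * `|x|) <= 2^-1 * `|x|.
    rewrite !mulrA ler_wpM2r// /kappa invfM mulrA ler_pdivrMr//.
    by rewrite [leRHS]mulrC ler_wpM2r ?invr_ge0// lerDl.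
  have := ler_wpM2l w0 H2; lra.
have uA' : A' \in unitmx.
  rewrite unitmxE unitfE; apply/negP; rewrite -det_tr => /det0P[v v0 vA'].
  move/negP: v0; apply; rewrite -(trmxK v) trmx_eq0 -normr_le0.
  apply: (le_trans (key _)); rewrite -[A' *m _]trmxK trmx_mul trmxK vA'.
  by rewrite trmx0 normr0 mulr0.
move=> z; exists (invmx A' *m z).
have Az : A' *m (invmx A' *m z) = z by rewrite mulmxA mulmxV// mul1mx.
by split => //; apply: (le_trans (key _)); rewrite Az.
Qed.

End matrix_stability.

Lemma int_legendre_uniform_lipschitz (R : realType) l (idx : 'I_l -> nat) :
  exists2 C : R, 0 < C & forall j (s t : R), 0 <= s <= 1 -> 0 <= t <= 1 ->
    `|int_legendre (idx j) s - int_legendre (idx j) t| <= C * `|s - t|.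
Proof.
have /choice[Cf CfP] : forall j, exists C : R, 0 <= C /\
    forall s t : R, 0 <= s <= 1 -> 0 <= t <= 1 ->
    `|int_legendre (idx j) s - int_legendre (idx j) t| <= C * `|s - t|.
  by move=> j; have [C ? ?] := @int_legendre_lipschitz R (idx j); exists C.
(* The added 1 keeps the constant positive even when [l = 0]. *)
exists (\sum_j Cf j + 1).
  by rewrite ltr_wpDl// sumr_ge0// => j _; have [] := CfP j.
move=> j s t s01 t01; have [_ /(_ _ _ s01 t01)/le_trans] := CfP j; apply.
rewrite ler_wpM2r// (bigD1 j)//= -addrA lerDl addr_ge0// sumr_ge0// => i _.
by have [] := CfP i.
Qed.

Lemma Rintegral_sum (R : realType) d (T : measurableType d)
    (mu : {measure set T -> \bar R}) (I : finType) (F : I -> T -> R) :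
  (forall i, mu.-integrable setT (EFin \o F i)) ->
  mu.-integrable setT (EFin \o (fun x => \sum_i F i x)) /\
  \int[mu]_x (\sum_i F i x) = \sum_i \int[mu]_x F i x.
Proof.
move=> iF.
have E : EFin \o (fun x => \sum_i F i x) = (fun x => \sum_i (EFin \o F i) x)%E.
  by apply/funext => x /=; rewrite -sumEFin.
split; first by rewrite E; apply: integrable_sum => // i _; exact: iF.
rewrite [LHS]/Rintegral (_ : integral _ _ _ = \sum_i \int[mu]_x (EFin \o F i) x)%E.
  by rewrite -sum_fine// => i _; exact: (integrable_fin_num _ (iF i)).
rewrite -integral_sum//; apply: eq_integral => x _.
by rewrite -sumEFin.
Qed.

(** * Minimizers for a cdf close to F_0 in L^1 *)

Section deterministic.
Context {R : realType}.
Local Notation mu := (@lebesgue_measure R).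
Variables (phi : R -> \bar R) (a b : \bar R).
Hypothesis phi_ge0 : forall x, (0 <= phi x)%E.
Hypothesis phi_convex : strictly_convex phi.
Hypothesis phi1 : phi 1 = 0%E.
Hypotheses (a_lt1 : (a < 1%:E)%E) (b_gt1 : (1%:E < b)%E).
Hypothesis phi_dom : [set x | (phi x < +oo)%E] = [set x : R | (a < x%:E < b)%E].
Variables (l : nat) (idx : 'I_l -> nat).
Hypothesis idx_ge2 : forall j, (2 <= idx j)%N.
Variables (d : nat) (Theta : set 'cV[R]_d) (f : 'cV[R]_d -> 'cV[R]_l).
Variable F0 : probability (measurableTypeR R) R.
Variable theta0 : 'cV[R]_d.
Hypothesis theta0_in : Theta theta0.
Hypothesis theta0_uniq : forall theta, Theta theta -> f theta = f theta0 -> theta = theta0.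
Hypothesis f_cont : {within Theta, continuous f}.
Hypothesis Theta_compact : compact Theta.
Hypothesis Omega_unit : Omega idx (cdf_of F0) \in unitmx.

Let kof (F : R -> R) (j : 'I_l) (x : R) : R := int_legendre (idx j) (F x).
Let k0 := kof (cdf_of F0).
Hypothesis ik0 : forall j, mu.-integrable setT (EFin \o k0 j).
Hypothesis f_theta0 : f theta0 = moments k0.

Lemma min_divergence_moment F :
  min_divergence phi idx f F = moment_divergence phi (kof F) \o f.
Proof.
have -> : kof F = fun j x => Kvec idx (F x) j ord0.
  by apply/funext => j; apply/funext => x; rewrite mxE.
by [].
Qed.

(** All constants are fixed before [F] and depend on F_0 only; [k] and [k0] denote K(F) and
    K(F_0). *)
Lemma arginf_near_of_cdf_near eps : 0 < eps -> exists2 eta : R, 0 < eta &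
  forall F : R -> R, measurable_fun setT F -> (forall x, 0 <= F x <= 1) ->
    (\int[mu]_x `|F x - cdf_of F0 x|%:E <= eta%:E)%E ->
    arginf Theta (min_divergence phi idx f F) !=set0 /\
    forall theta, arginf Theta (min_divergence phi idx f F) theta ->
      `|theta - theta0| < eps.
Proof.
move=> eps0.
have [C C0 KL] := @int_legendre_uniform_lipschitz R l idx.
have kC F j x : (forall x, 0 <= F x <= 1) -> `|kof F j x| <= C.
  move=> F01; have := KL j (F x) 0 (F01 x); rewrite lexx ler01 int_legendre0 !subr0.
  have /andP[Fx0 Fx1] := F01 x; rewrite (ger0_norm Fx0) => /(_ isT)/le_trans; apply.
  by rewrite ler_piMr// ltW.
have F001 := cdf_of_itv01 F0.
pose B0 := \sum_j \int[mu]_x `|k0 j x|.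
have IB j : 0 <= \int[mu]_x `|k0 j x| by apply: Rintegral_ge0.
have B00 : 0 <= B0 by apply: sumr_ge0.
have kB0 j : \int[mu]_x `|k0 j x| <= B0.
  by rewrite /B0 (bigD1 j)//= lerDl; apply: sumr_ge0 => i _; exact: IB.
have [delta [M [delta0 M0 phi_lin]]] := phi_le_linear phi_ge0 phi_convex phi1 a_lt1 b_gt1 phi_dom.
have [kappa [Lambda [kappa0 Lambda0 Omega_near]]] := unitmx_stable Omega_unit.
(* A displacement |z| <= r is reached by h = lam . k0 with |lam| <= Lambda r, so that |h| <= l
   Lambda r C <= delta. Then [M1] bounds [M] times the integral of |h|. *)
pose r := delta / (l%:R * Lambda * C + 1).
have d0 : 0 < l%:R * Lambda * C + 1 by rewrite ltr_wpDl// mulr_ge0 ?(ltW C0)// mulr_ge0.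
have r0 : 0 < r by rewrite divr_gt0.
pose M1 := M * (Lambda * r * B0).
have M10 : 0 <= M1 by rewrite /M1 mulr_ge0// mulr_ge0// mulr_ge0 ?(ltW r0).
have [eta1 eta10 f_inj] := compact_unique_preimage_near Theta_compact f_cont theta0_uniq eps0.
(* [r / 4] keeps [rho] below [r / 2]. [eta1 / 2] allows for two errors: from f(theta) to
   [moments k], and from there to f(theta0). *)
pose rho := Num.min (r / 4) (eta1 / 2).
have rho0 : 0 < rho by rewrite lt_min !divr_gt0.
have rhor : rho < r / 2.
  by apply: (@le_lt_trans _ _ (r / 4)); rewrite ?ge_min ?lexx//; lra.
have rhoeta : rho <= eta1 / 2 by rewrite ge_min lexx orbT.
have [c c0 far] := @moment_divergence_lower R l phi a b phi_ge0 phi_convex phi1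
  a_lt1 b_gt1 phi_dom C (B0 + C) rho C0 (addr_ge0 B00 (ltW C0)) rho0.
pose N := 2 * M1 / r.
have N0 : 0 <= N by rewrite /N divr_ge0 ?(ltW r0)// mulr_ge0.
(* [q] will bound the L^1 distance of each k_j to k0_j. Its three terms give proximity of the
   moments, invertibility of the perturbed matrix, and a value of the criterion below [c] at
   theta0. *)
pose q := Num.min (rho / 2) (Num.min (kappa / C) (c / (2 * (N + 1)))).
have q0 : 0 < q by rewrite /q !lt_min !divr_gt0// mulr_gt0// ltr_wpDl.
have q_rho : q < rho.
  by apply: (@le_lt_trans _ _ (rho / 2)); rewrite ?ge_min ?lexx//; lra.
have q_kappa : C * q <= kappa.
  by rewrite mulrC -ler_pdivlMr// !ge_min lexx orbT.
have q_c : N * q < c.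
  have : q <= c / (2 * (N + 1)) by rewrite !ge_min lexx !orbT.
  move=> /(ler_wpM2l N0)/le_lt_trans; apply.
  rewrite mulrA ltr_pdivrMr ?mulr_gt0// ?ltr_wpDl// mulrC ltr_pM2l//; lra.
(* The bound 1 yields the integral bound [B0 + C] on |k_j| passed to [far], and [q / C] yields the
   bound [q]. *)
exists (Num.min 1 (q / C)); first by rewrite lt_min ltr01 divr_gt0.
move=> F mF F01 FF0; set k := kof F.
have mk (F' : R -> R) j : measurable_fun setT F' -> (forall x, 0 <= F' x <= 1) ->
    measurable_fun setT (kof F' j).
  by move=> *; exact: int_legendre_comp_measurable.
have mF0 := cdf_of_measurable F0.
have iFF0 : mu.-integrable setT (EFin \o (fun x => `|F x - cdf_of F0 x|)).
  apply/integrableP; split.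
    by apply/measurable_EFinP; apply: measurableT_comp => //; exact: measurable_funB.
  under eq_integral do rewrite /= normr_id.
  by rewrite (le_lt_trans FF0)// ltry.
have IFF0 : \int[mu]_x `|F x - cdf_of F0 x| <= Num.min 1 (q / C).
  by rewrite -lee_fin /Rintegral fineK//; exact: integrable_fin_num.
have kk0 j x : `|k j x - k0 j x| <= C * `|F x - cdf_of F0 x| by exact: KL.
have idk j : mu.-integrable setT (EFin \o (fun x => k j x - k0 j x)).
  apply: (@le_integrable _ _ _ mu _ measurableT _ (fun x => C%:E * `|F x - cdf_of F0 x|%:E)%E).
  - by apply/measurable_EFinP; apply: measurable_funB; exact: mk.
  - move=> x _; rewrite lee_fin (le_trans (kk0 j x))// ler_norm//.
  - exact: integrableZl.
have indk j : mu.-integrable setT (EFin \o (fun x => `|k j x - k0 j x|)) by exact: integrable_norm.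
have ik j : mu.-integrable setT (EFin \o k j).
  rewrite (_ : EFin \o k j = ((EFin \o (fun x => (k j x - k0 j x)%R)) \+ (EFin \o k0 j))%E).
    exact: (integrableD measurableT (idk j) (ik0 j)).
  by apply/funext => x /=; rewrite -EFinD subrK.
have Idk j : \int[mu]_x `|k j x - k0 j x| <= C * Num.min 1 (q / C).
  apply: (@le_trans _ _ (\int[mu]_x (C * `|F x - cdf_of F0 x|))).
    by apply: le_Rintegral => //; exact: (integrableZl measurableT C iFF0).
  by rewrite RintegralZl// ler_wpM2l// ltW.
have Idk_q j : \int[mu]_x `|k j x - k0 j x| <= q.
  apply: (le_trans (Idk j)); rewrite mulrC -ler_pdivlMr//.
  by rewrite ge_min lexx orbT.
have Idk_C j : \int[mu]_x `|k j x - k0 j x| <= C.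
  by apply: (le_trans (Idk j)); rewrite ler_piMr ?(ltW C0)// ge_min lexx.
have in0 j : mu.-integrable setT (EFin \o (fun x => `|k0 j x|)) by exact: integrable_norm.
have kB j : \int[mu]_x `|k j x| <= B0 + C.
  apply: (@le_trans _ _ (\int[mu]_x (`|k0 j x| + `|k j x - k0 j x|))).
    apply: le_Rintegral => //; first exact: integrable_norm.
      exact: (integrableD measurableT (in0 j) (indk j)).
    by move=> x _; rewrite -[X in `|X| <= _](subrKC (k0 j x)) ler_normD.
  by rewrite RintegralD// lerD.
have vn : `|f theta0 - moments k| <= q.
  rewrite f_theta0 distrC; apply: mx_norm_leP; first exact: ltW.
  move=> i j; rewrite !mxE -RintegralB//.
  exact: le_trans (le_normr_Rintegral measurableT (idk i)) (Idk_q i).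
have bounded_prod (g h : R -> R) D : mu.-integrable setT (EFin \o g) -> measurable_fun setT h ->
    (forall x, `|h x| <= D) -> mu.-integrable setT (EFin \o (fun x => g x * h x)).
  move=> ig mh hD; have mg : measurable_fun setT g.
    by apply/measurable_EFinP; exact: (measurable_int mu ig).
  apply: (@le_integrable _ _ _ mu _ measurableT _ (fun x => D%:E * (EFin \o g) x)%E).
  - by apply/measurable_EFinP; exact: measurable_funM.
  - move=> x _; rewrite lee_fin /= !normrM mulrC ler_wpM2r//.
    by rewrite (le_trans (hD x))// ler_norm.
  - exact: integrableZl.
(* A mixed Gram matrix: the moments of lam . k0 against the weights [k] are A lam. It lies within C
   q of Omega_0. *)
pose A := \matrix_(i, j) \int[mu]_x (k i x * k0 j x) : 'M[R]_l.
have AOmega : `|A - Omega idx (cdf_of F0)| <= kappa.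
  apply: mx_norm_leP => [|i j]; first exact: ltW.
  rewrite !mxE.
  have -> : \int[mu]_x (Kvec idx (cdf_of F0 x) *m (Kvec idx (cdf_of F0 x))^T) i j =
      \int[mu]_x (k0 i x * k0 j x).
    by apply: eq_Rintegral => x _; rewrite mxE big_ord1 !mxE.
  rewrite -RintegralB//; last 2 first.
    by apply: (bounded_prod _ _ C) => //; [exact: mk|move=> x; exact: kC].
    by apply: (bounded_prod _ _ C) => //; [exact: mk|move=> x; exact: kC].
  under eq_Rintegral do rewrite -mulrBl.
  have idkk : mu.-integrable setT (EFin \o (fun x => (k i x - k0 i x) * k0 j x)).
    by apply: (bounded_prod _ _ C) => //; [exact: mk|move=> x; exact: kC].
  apply: (le_trans (le_normr_Rintegral measurableT idkk)).
  apply: (@le_trans _ _ (\int[mu]_x (C * `|k i x - k0 i x|))).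
    apply: le_Rintegral => //.
    - exact: integrable_norm.
    - exact: (integrableZl measurableT C (indk i)).
    - by move=> x _; rewrite normrM mulrC ler_wpM2r// kC.
  rewrite RintegralZl//; apply: le_trans q_kappa.
  by rewrite ler_wpM2l// ltW.
have solve (z : 'cV[R]_l) : `|z| <= r -> exists h : R -> R,
    [/\ mu.-integrable setT (EFin \o h), forall x, `|h x| <= delta,
     forall j, \int[mu]_x (k j x * h x) = z j ord0 &
     M * \int[mu]_x `|h x| <= M1].
  move=> zr; have [lam [Alam lamz]] := Omega_near A AOmega z.
  have lamr i : `|lam i ord0| <= Lambda * r.
    apply: (le_trans (mx_entry_le_norm _ _ _)); apply: (le_trans lamz).
    by rewrite ler_wpM2l.
  pose h x := \sum_i lam i ord0 * k0 i x.
  have ihi i : mu.-integrable setT (EFin \o (fun x => lam i ord0 * k0 i x)).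
    exact: (integrableZl measurableT (lam i ord0) (ik0 i)).
  have [ih _] := Rintegral_sum ihi.
  have mh : measurable_fun setT h.
    by apply/measurable_EFinP; exact: (measurable_int mu ih).
  have hd x : `|h x| <= delta.
    apply: (le_trans (ler_norm_sum _ _ _)).
    apply: (@le_trans _ _ (\sum_(i < l) Lambda * r * C)).
      by apply: ler_sum => i _; rewrite normrM ler_pM// kC.
    rewrite sumr_const card_ord -(mulr_natl (_ * _)).
    rewrite (_ : _ * _ = delta * (l%:R * Lambda * C / (l%:R * Lambda * C + 1))); last first.
      by rewrite /r; ring.
    by rewrite ler_piMr ?(ltW delta0)// ler_pdivrMr// mul1r lerDl.
  exists h; split => // [j|].
    have ikh i : mu.-integrable setT (EFin \o (fun x => k j x * (lam i ord0 * k0 i x))).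
      apply: (bounded_prod _ _ (`|lam i ord0| * C)) => //.
        by apply: measurable_funM => //; exact: mk.
      by move=> x; rewrite normrM ler_wpM2l// kC.
    have ikk i : mu.-integrable setT (EFin \o (fun x => k j x * k0 i x)).
      by apply: (bounded_prod _ _ C) => //; [exact: mk|move=> x; exact: kC].
    have [_ E] := Rintegral_sum ikh.
    rewrite -Alam mxE; under eq_Rintegral do rewrite /h mulr_sumr.
    rewrite E; apply: eq_bigr => i _; rewrite mxE.
    by rewrite mulrC -RintegralZl//; apply: eq_Rintegral => x _; ring.
  rewrite /M1 ler_wpM2l//.
  have inl i : mu.-integrable setT (EFin \o (fun x => `|lam i ord0| * `|k0 i x|)).
    exact: (integrableZl measurableT (`|lam i ord0|) (in0 i)).
  have [isum E] := Rintegral_sum inl.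
  apply: (@le_trans _ _ (\int[mu]_x (\sum_i `|lam i ord0| * `|k0 i x|))).
    apply: le_Rintegral => //; first exact: integrable_norm.
    move=> x _; apply: (le_trans (ler_norm_sum _ _ _)).
    by apply: ler_sum => i _; rewrite normrM.
  rewrite E /B0 mulr_sumr; apply: ler_sum => i _.
  by rewrite RintegralZl// ler_wpM2r.
rewrite min_divergence_moment -/k.
have Dv0 : moment_divergence phi k (moments k) = 0%E.
  apply: moment_divergence_moments => // j.
  by apply/measurable_EFinP; exact: (measurable_int mu (ik j)).
have Dpert u z t : `|z| <= r -> 0 < t < 1 ->
    (moment_divergence phi k ((1 - t) *: u + t *: (moments k + z))%R <=
     moment_divergence phi k u + (t * M1)%:E)%E.
  move=> zr t01; have [h [ih hd kh hM]] := solve z zr.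
  apply: (le_trans (moment_divergence_perturb phi_ge0 phi_convex M0 phi_lin ik _ u ih hd kh t01)).
    by move=> j x; exact: kC.
  by rewrite leeD2l// lee_fin ler_wpM2l//; case/andP: t01 => /ltW.
have far' v : rho <= `|v - moments k| -> (c%:E <= moment_divergence phi k v)%E.
  move=> vr; apply: (far k v ik) => //.
    by move=> j x; exact: kC.
  have [|i [j E]] := @mx_norm_attained R _ _ (v - moments k).
    exact: lt_le_trans vr.
  by exists i; move: vr; rewrite E !mxE (ord1 j).
have vn_rho : `|f theta0 - moments k| < rho by exact: le_lt_trans q_rho.
have vn_c : 2 * M1 / r * `|f theta0 - moments k| < c.
  by apply: le_lt_trans q_c; rewrite ler_wpM2l.
have [S0 Snear] := arginf_localized r0 M10 (moment_divergence_ge0 k ^~ phi_ge0) Dv0 Dpert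
  Theta_compact f_cont theta0_in rho0 rhor far' vn_rho vn_c.
split => // theta Stheta; apply: f_inj; first by case: Stheta.
rewrite -(subrK (moments k) (f theta)) -addrA (le_lt_trans (ler_normD _ _))//.
have := Snear _ Stheta; move: vn q_rho rhoeta; rewrite distrC; lra.
Qed.

End deterministic.

(** * Convergence of the empirical distribution function in mean *)

Lemma ecdf_itv01 (R : realType) n (s : 'I_n -> R) x : 0 <= ecdf s x <= 1.
Proof.
apply/andP; split; first by rewrite /ecdf divr_ge0// sumr_ge0.
(* For an empty sample [ecdf] is identically 0. *)
case: n s => [|n] s; first by rewrite /ecdf big_ord0 mul0r.
rewrite /ecdf ler_pdivrMr ?ltr0n// mul1r.
apply: (@le_trans _ _ (\sum_(i < n.+1) 1)); last by rewrite sumr_const card_ord.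
by apply: ler_sum => i _; rewrite lern1 leq_b1.
Qed.

Lemma ecdf_measurable_prod (R : realType) d (T : measurableType d) n
    (X : 'I_n -> T -> R) : (forall i, measurable_fun setT (X i)) ->
  measurable_fun setT (fun p : T * measurableTypeR R => ecdf (fun i => X i p.1) (p.2 : R)).
Proof.
move=> mX; rewrite /ecdf; apply: measurable_funM => //.
apply: measurable_sum => i.
have m1 : measurable_fun setT (fun p : T * measurableTypeR R => X i p.1).
  exact: (measurableT_comp (mX i) measurable_fst).
have m2 : measurable_fun setT (fun p : T * measurableTypeR R => (p.2 : R)) := measurable_snd.
apply: (measurableT_comp (f := fun b : bool => b%:R : R)) => //.
exact: measurable_fun_ler.
Qed.

Lemma ecdf_measurable (R : realType) n (s : 'I_n -> R) : measurable_fun setT (ecdf s).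
Proof.
rewrite /ecdf; apply: measurable_funM => //; apply: measurable_sum => i.
apply: (measurableT_comp (f := fun b : bool => b%:R : R)) => //.
by apply: measurable_fun_ler => //; exact: measurable_cst.
Qed.

Section empirical.
Context {R : realType} {dT : measure_display} {T : measurableType dT}.
Variables (P : probability T R) (F0 : probability (measurableTypeR R) R).
Variable X : nat -> {RV P >-> R}.
Hypothesis X_indep : mutually_independent X.
Hypothesis X_law : forall i, has_law F0 (X i).
Local Notation mu := (@lebesgue_measure R).
Local Notation F := (cdf_of F0).

Let A x i := X i @^-1` [set` `]-oo, x]].
Let Y x i w : R := \1_(A x i) w - F x.

Let mA x i : measurable (A x i).
Proof. exact: measurable_funPTI. Qed.

Let PA x i : P (A x i) = (F x)%:E.
Proof. by rewrite EFin_cdf_of -(X_law i). Qed.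

Let PAI x i j : i != j -> P (A x i `&` A x j) = (F x ^+ 2)%:E.
Proof.
move=> ij; have u : uniq [:: i; j] by rewrite /= mem_seq1 ij.
have := X_indep (A := fun=> [set` `]-oo, x]]) u (fun=> measurable_itv _).
rewrite !big_cons big_nil mule1 -/(A x i) -/(A x j) !PA -EFinM expr2 => <-.
congr (P _); apply/seteqP; split => w /=.
- by move=> [Ai Aj] k /=; rewrite in_cons mem_seq1 => /orP[] /eqP ->.
- by move=> H; split; apply: H; rewrite /= in_cons mem_seq1 eqxx ?orbT.
Qed.

Let ind B (mB : measurable B) : P.-integrable setT (EFin \o (\1_B : T -> R)).
Proof. exact: integrable_indic. Qed.

Let Rind B (mB : measurable B) : \int[P]_w (\1_B w : R) = fine (P B).
Proof. by rewrite /Rintegral integral_indic// setIT. Qed.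

Let icst (c : R) : P.-integrable setT (EFin \o (cst c : T -> R)).
Proof. exact: finite_measure_integrable_cst. Qed.

Let Rcst (c : R) : \int[P]_w c = c.
Proof. by rewrite Rintegral_cst//= probability_setT mulr1. Qed.

Let iY x i : P.-integrable setT (EFin \o Y x i).
Proof. exact: (integrableB measurableT (ind (mA x i)) (icst (F x))). Qed.

Let absY x i : \int[P]_w `|Y x i w| <= 2 * (F x * (1 - F x)).
Proof.
have /andP[F_0 F_1] := cdf_of_itv01 F0 x.
(* |Y| takes the value 1 - F on the event and F off it, hence is affine in the indicator. *)
have -> : \int[P]_w `|Y x i w| = \int[P]_w ((1 - 2 * F x) * \1_(A x i) w + F x).
  apply: eq_Rintegral => w _; rewrite /Y indicE; case: (w \in _) => /=.
    by rewrite ger0_norm ?subr_ge0//; lra.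
  by rewrite sub0r normrN ger0_norm//; lra.
have i1 : P.-integrable setT (EFin \o (fun w => (1 - 2 * F x) * \1_(A x i) w)).
  exact: (integrableZl measurableT (1 - 2 * F x) (ind (mA x i))).
rewrite RintegralD//; last exact: icst.
rewrite RintegralZl// ?Rind//; last exact: ind.
by rewrite PA/= Rcst; lra.
Qed.

Let YYE x i j w : Y x i w * Y x j w =
  \1_(A x i `&` A x j) w + (- F x * \1_(A x i) w + (- F x * \1_(A x j) w + F x ^+ 2)).
Proof. by rewrite /Y indicI /=; ring. Qed.

Let iYY_def x i j : P.-integrable setT (EFin \o (fun w => Y x i w * Y x j w)) /\
  \int[P]_w (Y x i w * Y x j w) = fine (P (A x i `&` A x j)) - F x ^+ 2.
Proof.
have iZ k : P.-integrable setT (EFin \o (fun w => - F x * \1_(A x k) w)).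
  exact: (integrableZl measurableT (- F x) (ind (mA x k))).
have i2 : P.-integrable setT (EFin \o (fun w => - F x * \1_(A x j) w + F x ^+ 2)).
  exact: (integrableD measurableT (iZ j) (icst (F x ^+ 2))).
have i3 : P.-integrable setT (EFin \o (fun w => - F x * \1_(A x i) w +
    (- F x * \1_(A x j) w + F x ^+ 2))).
  exact: (integrableD measurableT (iZ i) i2).
have mAI : measurable (A x i `&` A x j) by exact: measurableI.
have E : (fun w => Y x i w * Y x j w) = (fun w => \1_(A x i `&` A x j) w +
    (- F x * \1_(A x i) w + (- F x * \1_(A x j) w + F x ^+ 2))).
  by apply/funext => w; rewrite YYE.
rewrite E; split; first exact: (integrableD measurableT (ind mAI) i3).
rewrite RintegralD//; last exact: ind.
rewrite RintegralD//.
rewrite RintegralD//; last exact: icst.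
rewrite RintegralZl//; last exact: ind.
rewrite RintegralZl//; last exact: ind.
by rewrite !Rind// !PA/= Rcst; ring.
Qed.

Let Z n x w : R := ecdf (fun i : 'I_n => X i w) x - F x.

Let ZE n x w : (0 < n)%N -> Z n x w = n%:R^-1 * \sum_(i < n) Y x i w.
Proof.
move=> n0; rewrite /Z /ecdf mulrC /Y big_split/= sumr_const card_ord mulrDr.
congr (_ * _ + _).
  apply: eq_bigr => i _; rewrite indicE.
  by have -> : (w \in A x i) = (X i w <= x) by apply/idP/idP; rewrite inE /A/= in_itv/=.
by rewrite -(mulr_natl (- _)) mulKf// pnatr_eq0 -lt0n.
Qed.

Let iZ n x : (0 < n)%N -> P.-integrable setT (EFin \o Z n x).
Proof.
move=> n0; have [iS _] := Rintegral_sum (fun i : 'I_n => iY x i).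
rewrite (_ : Z n x = fun w => n%:R^-1 * \sum_(i < n) Y x i w).
  exact: (integrableZl measurableT n%:R^-1 iS).
by apply/funext => w; rewrite ZE.
Qed.

Let inZ n x : (0 < n)%N -> P.-integrable setT (EFin \o (fun w => `|Z n x w|)).
Proof. by move=> n0; apply: integrable_norm; exact: iZ. Qed.

(** Triangle inequality on the mean of the centred indicators; uniform in n, this provides the
    domination. *)
Let meanZ_tail n x : (0 < n)%N -> \int[P]_w `|Z n x w| <= 2 * cdf_tail F0 x.
Proof.
move=> n0; have n0' : 0 < n%:R :> R by rewrite ltr0n.
have inY i : P.-integrable setT (EFin \o (fun w => `|Y x i w|)).
  by apply: integrable_norm; exact: iY.
have [iS SE] := Rintegral_sum (fun i : 'I_n => inY i).
apply: (@le_trans _ _ (\int[P]_w (n%:R^-1 * \sum_(i < n) `|Y x i w|))).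
  apply: le_Rintegral => //; first exact: inZ.
    exact: (integrableZl measurableT n%:R^-1 iS).
  move=> w _; rewrite ZE// normrM ger0_norm ?invr_ge0 ?ler0n//.
  by rewrite ler_wpM2l ?invr_ge0 ?ler0n// ler_norm_sum.
rewrite RintegralZl// SE mulrC ler_pdivrMr//.
apply: (@le_trans _ _ (\sum_(i < n) 2 * cdf_tail F0 x)); last first.
  by rewrite sumr_const card_ord -[leLHS]mulr_natr.
apply: ler_sum => i _; apply: (le_trans (absY x i)).
by rewrite ler_wpM2l// cdf_of_mul_le_tail.
Qed.

Let meanZ_sqrt n x : (0 < n)%N -> \int[P]_w `|Z n x w| <= (Num.sqrt n%:R)^-1.
Proof.
move=> n0; have n0' : 0 < n%:R :> R by rewrite ltr0n.
pose s := (Num.sqrt n%:R)^-1 : R; have s0 : 0 < s by rewrite invr_gt0 sqrtr_gt0.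
have ss : s ^+ 2 = n%:R^-1 by rewrite exprVn sqr_sqrtr// ltW.
have [iS SE] := Rintegral_sum (fun ij : 'I_n * 'I_n => (iYY_def x ij.1 ij.2).1).
(* [Q] is the square of the sum of the Y_i; by independence only the n diagonal terms, each at most
   1 in mean, survive integration. *)
pose Q w := \sum_(ij : 'I_n * 'I_n) Y x ij.1 w * Y x ij.2 w.
have IQ : \int[P]_w Q w <= n%:R.
  rewrite SE -(pair_bigA _ (fun i j : 'I_n => \int[P]_w (Y x i w * Y x j w)))/=.
  apply: (@le_trans _ _ (\sum_(i < n) 1)); last by rewrite sumr_const card_ord.
  apply: ler_sum => i _; rewrite (bigD1 i)//= big1 => [|j ji].
    rewrite addr0 (iYY_def x i i).2 setIid PA /=.
    have /andP[F_0 F_1] := cdf_of_itv01 F0 x.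
    by have := sqr_ge0 (F x); lra.
  by rewrite (iYY_def x i j).2 PAI 1?eq_sym//= subrr.
(* AM-GM, [|z| <= s / 2 + z ^ 2 / (2 s)] with [s = 1 / sqrt n], in place of
   Cauchy-Schwarz. *)
have Zs w : `|Z n x w| <= s / 2 + (s / 2 / n%:R) * Q w.
  have -> : s / 2 / n%:R * Q w = (Z n x w) ^+ 2 / (2 * s).
    have -> : Q w = (\sum_(i < n) Y x i w) ^+ 2.
      by rewrite /Q expr2 big_distrlr/= pair_bigA.
    rewrite ZE// exprMn.
    set V := \sum_(i < n) _; have -> : n%:R^-1 ^+ 2 = s ^+ 2 * n%:R^-1 :> R by rewrite ss expr2.
    by field; rewrite !gt_eqF.
  rewrite -(real_normK (num_real (Z n x w))); set z := `|_|.
  have : 0 <= (z - s) ^+ 2 / (2 * s) by rewrite divr_ge0 ?sqr_ge0// mulr_ge0// ltW.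
  have -> : (z - s) ^+ 2 / (2 * s) = s / 2 + z ^+ 2 / (2 * s) - z.
    by field; rewrite gt_eqF.
  by rewrite subr_ge0.
have i1 : P.-integrable setT (EFin \o (fun w => s / 2 / n%:R * Q w)).
  exact: (integrableZl measurableT (s / 2 / n%:R) iS).
apply: (@le_trans _ _ (\int[P]_w (s / 2 + (s / 2 / n%:R) * Q w))).
  apply: le_Rintegral => //; first exact: inZ.
  exact: (integrableD measurableT (icst (s / 2)) i1).
rewrite RintegralD//; last exact: icst.
rewrite Rcst RintegralZl//.
have : s / 2 / n%:R * \int[P]_w Q w <= s / 2.
  rewrite -mulrA ler_piMr ?divr_ge0 ?(ltW s0)//.
  by rewrite mulrC ler_pdivrMr// mul1r.
by rewrite -/s; lra.
Qed.

Let W n w : \bar R := (\int[mu]_x `|ecdf (fun i : 'I_n => X i w) x - F x|%:E)%E.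

Let mf n : measurable_fun setT
  (fun p : T * measurableTypeR R => `|ecdf (fun i : 'I_n => X i p.1) (p.2 : R) - F p.2|%:E).
Proof.
apply/measurable_EFinP; apply: measurableT_comp => //; apply: measurable_funB.
  by apply: (@ecdf_measurable_prod R dT T n (fun i => X i)) => i.
by apply: (measurableT_comp (cdf_of_measurable F0) measurable_snd).
Qed.

Lemma ecdf_distance_measurable n : measurable_fun setT (W n).
Proof.
by apply: (measurable_fun_fubini_tonelli_F (m2 := mu) _ (mf n)) => p; rewrite lee_fin.
Qed.

Let meanW n : (0 < n)%N -> (\int[P]_w W n w <=
  \int[mu]_x (Num.min (Num.sqrt n%:R)^-1 (2 * cdf_tail F0 x))%:E)%E.
Proof.
move=> n0; rewrite /W.
have := @fubini_tonelli _ _ _ _ R P mu _ (mf n); rewrite /= => ->; last first.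
  by move=> p; rewrite lee_fin.
apply: ge0_le_lower_integral => x; first by apply: integral_ge0 => w _; rewrite lee_fin.
have : \int[P]_w `|Z n x w| <= Num.min (Num.sqrt n%:R)^-1 (2 * cdf_tail F0 x).
  by rewrite le_min meanZ_sqrt// meanZ_tail.
rewrite -lee_fin /Rintegral fineK//.
by apply: integrable_fin_num => //; exact: inZ.
Qed.

(** Markov's inequality bounds the probability by the mean distance over [eta], and dominated
    convergence sends the bound [meanW] to 0. *)
Lemma ecdf_distance_cvg (eta : R) : mu.-integrable setT (EFin \o cdf_tail F0) ->
  0 < eta -> P [set w | (eta%:E <= W n w)%E] @[n --> \oo] --> 0%E.
Proof.
(* The shift to [n.+1] leaves out the empty sample, as the bounds on the mean ask for n > 0. *)
move=> itail eta0; rewrite -(cvg_shiftS (fun n => P [set w | (eta%:E <= W n w)%E])) /=.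
pose g n x := Num.min (Num.sqrt n.+1%:R)^-1 (2 * cdf_tail F0 x) : R.
have g0 n x : 0 <= g n x.
  by rewrite /g le_min invr_ge0 sqrtr_ge0/= mulr_ge0// cdf_tail_ge0.
have sqrt0 : (Num.sqrt n.+1%:R)^-1 @[n --> \oo] --> (0 : R).
  have -> : (fun n => (Num.sqrt n.+1%:R)^-1 : R) = Num.sqrt \o harmonic.
    by apply/funext => n /=; rewrite sqrtrV.
  rewrite -[X in _ --> X]sqrtr0; apply: continuous_cvg; first exact: sqrt_continuous.
  exact: cvg_harmonic.
have gint : (\int[mu]_x (g n x)%:E)%E @[n --> \oo] --> 0%E.
  have mg n : measurable_fun setT (g n).
    apply: measurable_minr; first exact: measurable_cst.
    by apply: measurable_funM => //; exact: cdf_tail_measurable.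
  have gg : forall x, (g n x)%:E @[n --> \oo] --> 0%E.
    move=> x; apply: cvg_EFin; first exact: nearW.
    apply: (@squeeze_cvgr _ _ _ _ (cst 0) (fun n => (Num.sqrt n.+1%:R)^-1)).
    - by apply: nearW => n; rewrite g0/= ge_min lexx.
    - exact: cvg_cst.
    - exact: sqrt0.
  have [| | | | |_ _] := @dominated_convergence _ _ R mu setT measurableT
    (fun n x => (g n x)%:E) (cst 0%E) (fun x => 2%:E * (EFin \o cdf_tail F0) x)%E.
  - by move=> n; apply/measurable_EFinP; exact: mg.
  - exact: measurable_cst.
  - by apply: aeW => x _; exact: gg.
  - exact: integrableZl.
  - apply: aeW => x n _; rewrite lee_fin ger0_norm//.
    by rewrite ge_min lexx orbT.
  by rewrite integral0.
have h0 : ((eta^-1)%:E * \int[mu]_x (g n x)%:E)%E @[n --> \oo] --> 0%E.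
  by rewrite -[X in _ --> X](mule0 (eta^-1)%:E); exact: cvgeZl.
apply: (squeeze_cvge _ (@cvg_cst _ 0%E nat \oo _) h0).
apply: nearW => n; rewrite measure_ge0/=.
  have W0 w : (0 <= W n.+1 w)%E by apply: integral_ge0 => x _; rewrite lee_fin.
  have := @le_integral_abse _ _ _ P setT measurableT _ _ (ecdf_distance_measurable n.+1) eta0.
  rewrite setTI; under eq_set do rewrite gee0_abs//.
  under eq_integral do rewrite gee0_abs//.
  move=> /le_trans/(_ (meanW (ltn0Sn n))); rewrite -/(g n).
  by rewrite lee_pdivlMl.
Qed.

End empirical.

(** * Consistency of the estimator *)

Theorem theorem7p1 (R : realType)
  (* the divergence function *)
  (phi : R -> \bar R) (a b : \bar R)
  (phi_ge0 : forall x, (0 <= phi x)%E)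
  (phi_convex : strictly_convex phi)
  (phi1 : phi 1 = 0%E)
  (a_lt1 : (a < 1%:E)%E) (b_gt1 : (1%:E < b)%E)
  (phi_dom : [set x | (phi x < +oo)%E] = [set x : R | (a < x%:E < b)%E])
  (* the orders of the constrained L-moments *)
  (l : nat) (idx : 'I_l -> nat)
  (idx_ge2 : forall j, (2 <= idx j)%N)
  (idx_incr : {homo idx : j k / (j < k)%N})
  (* the parameter space *)
  (d : nat) (Theta : set 'cV[R]_d) (f : 'cV[R]_d -> 'cV[R]_l)
  (* the i.i.d. sample *)
  (dT : measure_display) (T : measurableType dT) (P : probability T R)
  (F0 : probability (measurableTypeR R) R)
  (X : nat -> {RV P >-> R})
  (X_indep : mutually_independent X)
  (X_law : forall i, has_law F0 (X i))
  (F0_var : ('V_F0[fun x : R => x] < +oo)%E)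
  (* (i) *)
  (theta0 : 'cV[R]_d) (theta0_in : Theta theta0)
  (F0_model : Lmodel idx f theta0 F0)
  (theta0_uniq : forall theta, Theta theta -> f theta = f theta0 ->
                   theta = theta0)
  (* (ii) *)
  (f_cont : {within Theta, continuous f}) (Theta_compact : compact Theta)
  (* (iii) *)
  (Omega_unit : Omega idx (cdf_of F0) \in unitmx)
  (* the minimum divergence estimator, for the sample X_0, ..., X_{n-1} *)
  (thetahat : nat -> T -> 'cV[R]_d)
  (thetahat_arginf : forall (n : nat) (w : T), (0 < n)%N ->
     let Fn := ecdf (fun i : 'I_n => X i w) in
     let S := arginf Theta (min_divergence phi idx f Fn) in
     S !=set0 -> S (thetahat n w)) :
  cvg_in_probability P thetahat theta0.
Proof.
have itail := cdf_tail_integrable (finite_variance_integrable F0_var).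
have ik0 j := int_legendre_cdf_integrable (idx_ge2 j) itail.
have f_theta0 : f theta0 = moments (fun j x => int_legendre (idx j) (cdf_of F0 x)).
  apply/matrixP => j i; rewrite (ord1 i) mxE.
  have LE u : Lvec idx u j ord0 = shifted_legendre (idx j).-1 u by rewrite mxE.
  have [iL IL] := F0_model j; apply: oppr_inj; rewrite -IL.
  rewrite -(lmoment_int_legendre (idx_ge2 j) (ik0 j)).
    by apply: eq_Rintegral => u _; rewrite LE.
  by apply: eq_integrable iL => // u _; rewrite LE.
move=> eps eps0.
have [eta eta0 near_eta] := arginf_near_of_cdf_near phi_ge0 phi_convex phi1 a_lt1 b_gt1
  phi_dom theta0_in theta0_uniq f_cont Theta_compact Omega_unit ik0 f_theta0 eps0.
have := ecdf_distance_cvg X_indep X_law itail eta0.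
(* For n > 0, [thetahat] at distance at least [eps] forces the L^1 distance of the cdfs to be at
   least [eta]. *)
apply: squeeze_cvge; last exact: cvg_cst.
near=> n; rewrite outer_measure_ge0/=.
have n0 : (0 < n)%N by near: n; exists 1%N.
(* The event on the distance is measurable; the one on [thetahat] may not be, and is compared with
   it by monotonicity of the outer measure. *)
rewrite -measurable_mu_extE; last first.
  rewrite -[X in measurable X]setTI; apply: emeasurable_fun_c_infty => //.
  exact: ecdf_distance_measurable.
apply: le_outer_measure => w /= epsw.
rewrite leNgt; apply/negP => /ltW Wn.
have [||S0 Snear] := near_eta (ecdf (fun i : 'I_n => X i w)) _ _ Wn.
- exact: ecdf_measurable.
- exact: ecdf_itv01.
have := Snear _ (thetahat_arginf n w n0 S0).
by rewrite ltNge epsw.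
Unshelve. all: by end_near. Qed.
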